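(* For every $K>0$ there exist constants $c_1,c_2>0$ depending only on $K$ such that the following holds. If $A$ is a finite set of integers with $|A+A|\le K|A|$, then there exists a subset $A'\subseteq A$ such that $EI(A')\ge c_1|A'|^3$ and $|A'|\ge c_2|A|$.
   Context: The sumset is $A+B:=\{a+b:a\in A,\ b\in B\}$. For a finite set of integers $S=\{s_1<s_2<\cdots<s_m\}$ (listed in increasing order), the indexed energy is $EI(S)=|\{(i,j,k,l)\in\{1,\ldots,m\}^4: s_i+s_j=s_k+s_l \text{ and } i+j=k+l\}|$. For a subset $A'\subseteq A$, $EI(A')$ is computed with the elements of $A'$ reindexed in increasing order (indices are not inherited from $A$). *)

(* Defs.v *)
From mathcomp Require Import all_boot all_order all_algebra.
From mathcomp Require Import finmap.

Set Implicit Arguments.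
Unset Strict Implicit.
Unset Printing Implicit Defensive.

Import Order.TTheory GRing.Theory Num.Theory.

Local Open Scope fset_scope.
Local Open Scope ring_scope.

Definition sumset (A B : {fset int}) : {fset int} :=
  [fset a + b | a in A, b in B].

Definition increasing_enum (S : {fset int}) : seq int :=
  sort <=%R (enum_fset S).

(* Indices run over 0, ..., m - 1 instead of 1, ..., m; the condition
   i + j = k + l is invariant under this shift. *)
Definition EI (S : {fset int}) : nat :=
  let s (i : 'I_#|` S|) : int := nth 0 (increasing_enum S) i in
  #|[set t : 'I_#|` S| * 'I_#|` S| * 'I_#|` S| * 'I_#|` S| |
      let: (i, j, k, l) := t in
      (s i + s j == s k + s l) && (i + j == k + l)%N]|.

(* Main.v *)
(* Ruzsa's model lemma and Bogolyubov's lemma produce, on a dense subset of A,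
   boundedly many real coordinates (lifts of characters) which together with the
   integer value embed 2A - 2A, near 0, as the intersection W of a group with a
   box.  Let u be the smallest positive element of W.  Up to a bounded dilation of
   the box, the order of the integers is lexicographic on W: first the order of the
   projection along u, then the multiple of u.  The projection of W is again the
   intersection of a group with a box, with one coordinate fewer, so by induction a
   dense B in A has an increasing labelling phi by an interval of length O(|A|)
   such that phi a + phi b takes O(1) values once a + b is fixed.

   Scan the labels t and keep an element of B whenever at most t / q elements have
   been kept so far.  For q large enough, a positive proportion of B consists of kept
   elements whose rank is exactly t %/ q.  For these, (a + b, rank a + rank b) takes
   O(|A|) values, and the Cauchy-Schwarz inequality bounds the indexed energy of the
   kept set from below. *)

Require Import Defs.
From HB Require Import structures.
From mathcomp Require Import all_boot all_order all_algebra.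
From mathcomp Require Import finmap.
From mathcomp Require Import boolp reals trigo.
From mathcomp Require Import zify ring lra.

Set Implicit Arguments.
Unset Strict Implicit.
Unset Printing Implicit Defensive.

Import Order.TTheory GRing.Theory Num.Theory.

Local Open Scope fset_scope.
Local Open Scope ring_scope.

(** * Local groups and the lexicographic labelling *)

Section LocalGroups.
Variables (F : archiRealFieldType) (V : lmodType F) (I : eqType).
Variables (iota : {scalar V}) (c : I -> {scalar V}).
Implicit Types (s : seq I) (r R : F) (W B : {fset V}) (x y z u v : V).

Lemma scalar_addMn (f : {scalar V}) x y n : f (x + y *+ n) = f x + n%:R * f y.
Proof. by rewrite -scaler_nat addrC linearP addrC. Qed.

Definition in_box s r : pred V := fun x => all (fun i => `|c i x| <= r) s.

(* W behaves like the intersection of a subgroup of V with the box. *)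
Definition local_group s R W :=
  [/\ 0 \in W, {in W, forall x, in_box s R x}, {in W, forall x, - x \in W} &
      {in W &, forall x y, in_box s R (x + y) -> x + y \in W}].

Lemma in_boxP s r x :
  reflect (forall i, i \in s -> `|c i x| <= r) (in_box s r x).
Proof. exact: allP. Qed.

(** By convexity, each coordinate of [x + v *+ j] lies between those of [x] and of [x + v *+ k], so
    no intermediate point leaves the box and closure applies one step at a time. *)
Lemma local_group_walk s R W x v k : local_group s R W ->
  x \in W -> v \in W -> in_box s R (x + v *+ k) -> x + v *+ k \in W.
Proof.
move=> [W0 Wbox WN WD] xW vW /in_boxP xkbox.
suff: forall j, (j <= k)%N -> x + v *+ j \in W by apply.
elim=> [|j IHj] ltjk; first by rewrite mulr0n addr0.
rewrite mulrSr addrA; apply: WD => //; first by apply: IHj; lia.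
apply/in_boxP => i i_s; have := xkbox i i_s.
have /in_boxP/(_ i i_s) := Wbox x xW.
rewrite -addrA -mulrSr !scalar_addMn.
move: (c i x) (c i v) => a b /ler_normlP[h1 h2] /ler_normlP[h3 h4].
have jk : (j.+1%:R <= k%:R :> F) by rewrite ler_nat.
have j0 : (0 <= j.+1%:R :> F) by rewrite ler0n.
by apply/ler_normlP; case: (lerP 0 b) => b0; split; nra.
Qed.

Lemma local_group_walkz s R W x v (k : int) : local_group s R W ->
  x \in W -> v \in W -> in_box s R (x - k%:~R *: v) -> x - k%:~R *: v \in W.
Proof.
move=> Wlg xW vW; have [W0 Wbox WN WD] := Wlg.
case: k => k.
  rewrite -pmulrn scaler_nat -mulNrn; exact: (local_group_walk Wlg xW (WN _ vW)).
rewrite NegzE mulrNz scaleNr opprK -pmulrn scaler_nat.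
exact: (local_group_walk Wlg xW vW).
Qed.

(* Otherwise the finite set W would contain every multiple of u. *)
Lemma local_group_escape s R W u : local_group s R W ->
  u \in W -> 0 < iota u -> exists2 i, i \in s & c i u != 0.
Proof.
move=> Wlg uW u0; apply/hasP; apply: contraT => /hasPn cu0.
have W0 : 0 \in W by have [] := Wlg.
have kuW k : u *+ k \in W.
  rewrite -[u *+ k]add0r; apply: (local_group_walk Wlg) => //.
  apply/in_boxP => i i_s; rewrite scalar_addMn linear0 add0r.
  have /negbNE/eqP -> := cu0 i i_s.
  have [_ /(_ 0 W0)/in_boxP/(_ i i_s)] := Wlg.
  by rewrite linear0 mulr0.
have inj : injective (fun k : nat => u *+ k).
  move=> k l /(congr1 iota); rewrite -(add0r (u *+ k)) -(add0r (u *+ l)).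
  rewrite !scalar_addMn linear0 !add0r.
  by move/(mulIf (lt0r_neq0 u0))/eqP; rewrite eqr_nat => /eqP.
have : (size [seq u *+ k | k <- seq.iota 0 #|` W|.+1] <= #|` W|)%N.
  apply: uniq_leq_size; first by rewrite map_inj_uniq ?iota_uniq.
  by move=> _ /mapP[k _ ->]; exact: kuW.
by rewrite size_map size_iota ltnn.
Qed.
End LocalGroups.

(** * Projection of a local group along its smallest positive element *)

Section Quotient.
Variables (F : archiRealFieldType) (V : lmodType F) (I : eqType).
Variables (iota : {scalar V}) (c : I -> {scalar V}).
Variables (s : seq I) (R : F) (W : {fset V}) (u : V) (i : I).
Implicit Types (x y z : V).

Hypothesis R0 : 0 < R.
Hypothesis Wlg : local_group c s R W.
Hypothesis iota_inj : {in W, forall x, iota x = 0 -> x = 0}.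
Hypothesis uW : u \in W.
Hypothesis ubox : in_box c s (R / 8) u.
Hypothesis u0 : 0 < iota u.
Hypothesis umin : {in W, forall x, in_box c s (R / 8) x -> 0 < iota x -> iota u <= iota x}.
Hypothesis i_s : i \in s.
Hypothesis ciu0 : c i u != 0.
Hypothesis ciu_max : forall j, j \in s -> `|c j u| <= `|c i u|.

(** [slide] is the linear projection along [u] onto the kernel of [c i]; [slope] is the multiple of
    [u] that it removes. *)
Definition slope x := c i x / c i u.
Definition slide x := x - slope x *: u.

Lemma slopeB x y : slope (x - y) = slope x - slope y.
Proof. by rewrite /slope linearB mulrBl. Qed.

Lemma slopeD x y : slope (x + y) = slope x + slope y.
Proof. by rewrite /slope linearD mulrDl. Qed.

Lemma slopeZ a x : slope (a *: x) = a * slope x.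
Proof. by rewrite /slope linearZ mulrA. Qed.

Lemma slope_u : slope u = 1.
Proof. by rewrite /slope divff. Qed.

Lemma slideB x y : slide (x - y) = slide x - slide y.
Proof. by rewrite /slide slopeB scalerBl !opprB [X in _ + X = _]addrC addrACA [- y + _]addrC. Qed.

Lemma slideD x y : slide (x + y) = slide x + slide y.
Proof. by rewrite /slide slopeD scalerDl opprD addrACA. Qed.

Lemma slide0 : slide 0 = 0.
Proof. by rewrite /slide /slope linear0 mul0r scale0r subrr. Qed.

Lemma slideN x : slide (- x) = - slide x.
Proof. by rewrite -[- x]add0r slideB slide0 sub0r. Qed.

Lemma slideZu a : slide (a *: u) = 0.
Proof. by rewrite /slide slopeZ slope_u mulr1 subrr. Qed.

Lemma slide_stable x a : slide (x - a *: u) = slide x.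
Proof. by rewrite slideB slideZu subr0. Qed.

Lemma scalar_slide (f : {scalar V}) x : f x = f (slide x) + slope x * f u.
Proof. by rewrite /slide linearB linearZ /= subrK. Qed.

Lemma c_slide x : c i (slide x) = 0.
Proof. by rewrite /slide /slope linearB linearZ /= mulfVK // subrr. Qed.

Lemma u_minimal x : x \in W -> in_box c s (R / 8) x -> `|iota x| < iota u -> x = 0.
Proof.
move=> xW xbox xu; apply: iota_inj => //; have [_ _ WN _] := Wlg.
have [h|h|//] := ltrgt0P (iota x).
  have := umin xW xbox h; move: xu; rewrite gtr0_norm // => /lt_le_trans h1 /h1.
  by rewrite ltxx.
have := umin (WN _ xW) _ _; rewrite linearN oppr_gt0 => /(_ _ h) => h1.
move: xu; rewrite ltr0_norm // => /lt_le_trans h2.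
suff /h1/h2 : in_box c s (R / 8) (- x) by rewrite ltxx.
by apply/in_boxP => j js; rewrite linearN normrN; apply: (in_boxP _ _ _ _ xbox).
Qed.

(** Since [c i u] is the largest coordinate of [u], removing [slope x *: u] moves every coordinate
    by at most [|c i x|]. *)
Lemma slope_bound x r j : in_box c s (r * R) x -> j \in s -> `|slope x * c j u| <= r * R.
Proof.
move=> /in_boxP xbox js; have := xbox i i_s; apply: le_trans.
rewrite /slope !normrM normfV -mulrA ler_piMr // mulrC.
by rewrite ler_pdivrMr ?normr_gt0 // mul1r ciu_max.
Qed.

Lemma box8 x : in_box c s (R / 8) x -> in_box c s R x.
Proof.
by move=> /in_boxP h; apply/in_boxP => j js; apply: le_trans (h j js) _; move: R0 => R0'; lra.
Qed.

Lemma cu_le j : j \in s -> `|c j u| <= R / 8.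
Proof. exact: (in_boxP _ _ _ _ ubox). Qed.

(** Subtract the multiple of [u] nearest to the slope. The coordinates become at most
    [R / 16 + R / 16], so the walk along [u] ends inside [W]. *)
Lemma slide_rep x : x \in W -> in_box c s (R / 16) (slide x) ->
  exists y, [/\ y \in W, slide y = slide x, `|slope y| <= 1 / 2 & in_box c s (R / 8) y].
Proof.
move=> xW /in_boxP xbox.
set k := Num.floor (slope x + 1 / 2).
have /andP[k1 k2] : k%:~R <= slope x + 1 / 2 < (k + 1)%:~R := floor_itv _.
have e : slide (x - k%:~R *: u) = slide x by rewrite slide_stable.
have rk : `|slope (x - k%:~R *: u)| <= 1 / 2.
  rewrite slopeB slopeZ slope_u mulr1; apply/ler_normlP.
  by rewrite intrD mulr1z in k2; split; lra.
have ybox : in_box c s (R / 8) (x - k%:~R *: u).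
  apply/in_boxP => j js; rewrite scalar_slide e.
  apply: le_trans (ler_normD _ _) _; rewrite normrM.
  have := xbox j js; have := cu_le js; have := normr_ge0 (c j u).
  move: rk; set a := `|slope _|; have : 0 <= a := normr_ge0 _.
  move: (`|c j u|) (`|c j (slide x)|) => b d; nra.
exists (x - k%:~R *: u); split => //.
apply: (local_group_walkz Wlg) => //.
exact: box8.
Qed.

(** Both summands are replaced by representatives of slope at most 1/2; the new sum has coordinates
    at most [R / 16 + R / 8], so closure of [W] applies to it. *)
Lemma slide_sum x y : x \in W -> y \in W ->
  in_box c s (R / 16) (slide x) -> in_box c s (R / 16) (slide y) ->
  in_box c s (R / 16) (slide (x + y)) ->
  exists2 z, z \in W & slide z = slide (x + y).
Proof.
move=> /slide_rep xW /slide_rep yW /xW[x' [x'W ex rx _]] /yW[y' [y'W ey ry _]] xybox.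
have [_ _ _ WD] := Wlg.
have e : slide (x' + y') = slide (x + y) by rewrite !slideD ex ey.
exists (x' + y') => //; apply: WD => //.
apply/in_boxP => j js; rewrite scalar_slide e slopeD.
apply: le_trans (ler_normD _ _) _; rewrite normrM.
have := in_boxP _ _ _ _ xybox _ js; have := cu_le js; have := normr_ge0 (c j u).
have : `|slope x' + slope y'| <= 1.
  by apply: le_trans (ler_normD _ _) _; lra.
have := normr_ge0 (slope x' + slope y').
move: (`|_ + _|) (`|c j u|) (`|c j _|) => a b d; nra.
Qed.

(** The short representative has [iota] of size at most [iota u / 2], so it vanishes by minimality
    of [u]. *)
Lemma slide_iota_inj x : x \in W -> in_box c s (R / 16) (slide x) ->
  iota (slide x) = 0 -> slide x = 0.
Proof.
move=> /slide_rep xW /xW[y [yW <- ry ybox]] e0.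
suff -> : y = 0 by exact: slide0.
apply: u_minimal => //; rewrite scalar_slide e0 add0r normrM (gtr0_norm u0).
move: u0 => u0'; nra.
Qed.

(* Elements of W with small coordinates are ordered lexicographically: first by
   the value of iota on their projection along u, then by the multiple of u. *)
Lemma slide_mono z r : r <= 1 / 64 -> z \in W -> in_box c s (r * R) z ->
  0 < iota z -> slide z != 0 -> 0 < iota (slide z).
Proof.
move=> r64 zW zbox z0 sz0; rewrite ltNge; apply: contra sz0 => sneg.
have rz : iota z <= slope z * iota u by rewrite (scalar_slide iota z) gerDr.
(* By [rz], [k <= slope z], so removing [k] copies of [u] leaves coordinates at most [2 * r * R].
   What remains has [iota] in [[0, iota u)], hence is 0, and [z] is a multiple of [u]. *)
set k := Num.truncn (iota z / iota u).
have /andP[k1 k2] : k%:R <= iota z / iota u < k.+1%:R.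
  by apply: truncn_itv; rewrite divr_ge0 // ltW.
have k3 : k%:R <= slope z by apply: le_trans k1 _; rewrite ler_pdivrMr.
have k0 : (0 <= k%:R :> F) by [].
have ybox : in_box c s (R / 8) (z - (k%:Z)%:~R *: u).
  apply/in_boxP => j js; rewrite linearB linearZ /=.
  have := in_boxP _ _ _ _ zbox _ js; have := slope_bound zbox js.
  rewrite normrM (ger0_norm (le_trans k0 k3)) => h1 h2.
  apply: le_trans (ler_normB _ _) _; rewrite normrM ger0_norm //.
  have := normr_ge0 (c j u); move: h1 h2 k3 k0; rewrite -pmulrn.
  move=> h1 h2 k3 _ d0; have := ler_wpM2r d0 k3.
  have : r * R <= 1 / 64 * R by rewrite ler_pM2r.
  move: R0 => R0'; lra.
have yW : z - (k%:Z)%:~R *: u \in W.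
  apply: (local_group_walkz Wlg) => //.
  exact: box8.
rewrite -(slide_stable z (k%:Z)%:~R) (u_minimal yW ybox).
  by rewrite slide0.
rewrite linearB linearZ /= -pmulrn.
move: k1 k2; rewrite ler_pdivlMr // ltr_pdivrMr // -natr1 mulrDl mul1r => k1 k2.
rewrite ger0_norm; lra.
Qed.

(** Within one fibre of [slide], this makes truncated slopes strictly increasing with [iota]. *)
Lemma slope_ge1 z r : r <= 1 / 8 -> z \in W -> in_box c s (r * R) z ->
  0 < iota z -> slide z = 0 -> 1 <= slope z.
Proof.
move=> r8 zW /in_boxP zbox z0 sz0.
have zbox' : in_box c s (R / 8) z.
  by apply/in_boxP => j js; apply: le_trans (zbox j js) _; move: R0 => R0'; nra.
have := umin zW zbox' z0; rewrite {1}(scalar_slide iota z) sz0 linear0 add0r.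
by rewrite -[leLHS]mul1r ler_pM2r.
Qed.

(** Above each [x] in [W'], the points [rep x + u *+ k] with [k <= R / (2 |c i u|)] have coordinates
    at most [R / 8 + R / 2] and so lie in [W]. This keeps two-digit labels below the size of [W]. *)
Lemma card_slide (W' : {fset V}) :
  {in W', forall x, exists2 y, y \in W & slide y = x /\ in_box c s (R / 16) x} ->
  (#|` W'| * (Num.truncn (R / (2 * `|c i u|))).+1 <= #|` W|)%N.
Proof.
set h := Num.truncn _ => W'P.
have /andP[h1 h2] : h%:R <= R / (2 * `|c i u|) < h.+1%:R.
  by apply: truncn_itv; rewrite divr_ge0 ?(ltW R0) // mulr_ge0.
have repP x : exists y,
    (x \in W') ==> [&& y \in W, slide y == x & in_box c s (R / 8) y].
  case: (boolP (x \in W')) => [/W'P[y yW [<- ybox]]|_]; last by exists 0.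
  by have [z [zW ez _ zbox]] := slide_rep yW ybox; exists z; rewrite zW ez eqxx.
pose rep x := xchoose (repP x).
have repW x : x \in W' -> [/\ rep x \in W, slide (rep x) = x & in_box c s (R / 8) (rep x)].
  by move=> xW'; have /implyP/(_ xW')/and3P[? /eqP] := xchooseP (repP x).
have -> : (#|` W'| * h.+1)%N =
    size [seq rep x + u *+ k | x <- enum_fset W', k <- seq.iota 0 h.+1].
  by rewrite size_allpairs size_iota.
apply: uniq_leq_size.
  apply: allpairs_uniq; rewrite ?iota_uniq // ?fset_uniq //.
  move=> [x k] [y l] /allpairsPdep[x1 [k1 [x1W _ [-> ->]]]].
  move=> /allpairsPdep[y1 [l1 [y1W _ [-> ->]]]] {x y k l} /= e.
  have [_ ex _] := repW _ x1W; have [_ ey _] := repW _ y1W.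
  have exy : x1 = y1.
    rewrite -ex -ey -(slide_stable _ (- (k1%:R))) scaleNr opprK scaler_nat e.
    by rewrite -scaler_nat -[_ *: u]opprK -scaleNr slide_stable.
  move: e; rewrite exy => /addrI/(congr1 iota).
  rewrite -!scaler_nat !linearZ /= => /(mulIf (lt0r_neq0 u0))/eqP.
  by rewrite eqr_nat => /eqP ->.
move=> _ /allpairsPdep[x [k [/repW[xW ex xbox] kh ->]]].
apply: (local_group_walk Wlg) => //.
apply/in_boxP => j js; rewrite scalar_addMn.
apply: le_trans (ler_normD _ _) _; rewrite normrM (ger0_norm (ler0n _ _)).
have := in_boxP _ _ _ _ xbox _ js.
have : k%:R * `|c j u| <= R / 2.
  apply: (@le_trans _ _ (h%:R * `|c i u|)).
    apply: ler_pM => //; last exact: ciu_max.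
    by rewrite ler_nat; move: kh; rewrite mem_iota add0n ltnS.
  move: h1; rewrite ler_pdivlMr; last by rewrite mulr_gt0 ?normr_gt0.
  lra.
move: R0; lra.
Qed.
End Quotient.

Lemma exists_max_seq (d : Order.disp_t) (F : orderType d) (I : eqType)
    (f : I -> F) (s : seq I) (i0 : I) :
  i0 \in s -> exists2 i, i \in s & forall j, j \in s -> (f j <= f i)%O.
Proof.
elim: s i0 => // a s IHs i0 _; case: s IHs => [_|b s IHs].
  by exists a; rewrite ?mem_head // => j; rewrite inE => /eqP ->.
have [i i_s imax] := IHs b (mem_head _ _).
have [h|h] := leP (f a) (f i).
  exists i; first by rewrite inE i_s orbT.
  by move=> j; rewrite inE => /predU1P[->|/imax].
exists a; first exact: mem_head.
move=> j; rewrite inE => /predU1P[->//|/imax h2]; exact: le_trans h2 (ltW h).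
Qed.

Lemma exists_min_fset (d : Order.disp_t) (F : orderType d) (V : choiceType)
    (f : V -> F) (W : {fset V}) (P : pred V) :
  (exists2 x, x \in W & P x) ->
  exists u, [/\ u \in W, P u & {in W, forall x, P x -> (f u <= f x)%O}].
Proof.
move=> [x xW Px].
have xs : x \in [seq x <- enum_fset W | P x] by rewrite mem_filter Px.
have [u] := exists_max_seq (f : V -> F^d) xs.
rewrite mem_filter => /andP[Pu uW] umax; exists u; split => // y yW Py.
by have := umax y; rewrite mem_filter Py yW => /(_ isT).
Qed.

(** Rounding leaves two possible values, which doubles the number of label sums at each level of the
    induction. *)
Lemma truncn_pair (F : archiRealFieldType) (a b : F) : 0 <= a -> 0 <= b ->
  (Num.truncn a + Num.truncn b)%N \in
    [:: Num.truncn (a + b); (Num.truncn (a + b)).-1].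
Proof.
move=> a0 b0; have /andP[a1 a2] := truncn_itv a0.
have /andP[b1 b2] := truncn_itv b0.
have ab0 : 0 <= a + b by exact: addr_ge0.
have h1 : (Num.truncn a + Num.truncn b <= Num.truncn (a + b))%N.
  by rewrite truncn_ge_nat // natrD lerD.
have h2 : (Num.truncn (a + b) < (Num.truncn a).+1 + (Num.truncn b).+1)%N.
  by rewrite truncn_lt_nat // natrD ltrD.
rewrite !inE; lia.
Qed.

(** * Lexicographic labelling by induction on the number of coordinates *)

Section LexEnumeration.
Variables (F : archiRealFieldType) (V : lmodType F) (I : eqType).
Variables (iota : {scalar V}) (c : I -> {scalar V}).

(** Each projection shrinks the box by 16 and may double the coordinates of differences, hence 32
    per coordinate; 1/64 is the threshold of [slide_mono]. *)
Definition lex_radius d : F := (64 * 32 ^+ d)^-1.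

Lemma lex_radius_gt0 d : 0 < lex_radius d.
Proof. by rewrite invr_gt0 mulr_gt0 // exprn_gt0. Qed.

Lemma lex_radiusS d : lex_radius d = 32 * lex_radius d.+1.
Proof.
have h : (32 ^+ d : F) != 0 by rewrite lt0r_neq0 // exprn_gt0.
by rewrite /lex_radius exprS; field.
Qed.

Lemma lex_radius_le d : lex_radius d <= 1 / 64.
Proof.
elim: d => [|d]; first by rewrite /lex_radius expr0; lra.
by rewrite lex_radiusS; have := lex_radius_gt0 d.+1; lra.
Qed.

(** The label is written in base [h.+1]: the leading part is the inductive label of the projection,
    the last digit is a truncated slope. *)
Lemma lex_enumeration (s : seq I) (R : F) (W B : {fset V}) : 0 < R ->
  local_group c s R W -> {in W, forall x, iota x = 0 -> x = 0} ->
  {in B &, forall x y, x - y \in W /\ in_box c s (lex_radius (size s) * R) (x - y)} ->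
  exists phi : V -> nat,
    [/\ {in B &, forall x y, iota x < iota y -> (phi x < phi y)%N},
        {in B, forall x, (phi x < #|` W|)%N} &
        forall v, exists2 L : seq nat, (size L <= 2 ^ size s)%N &
          {in B &, forall x y, x + y = v -> (phi x + phi y)%N \in L}].
Proof.
have [d] := ubnP (size s); elim: d s R W B => // d IHd s R W B ltsd R0 Wlg iota_inj BW.
have [W0 Wbox WN WD] := Wlg.
have R64 : lex_radius (size s) * R <= R / 8.
  by have := lex_radius_le (size s); nra.
have box8 z : in_box c s (lex_radius (size s) * R) z -> in_box c s (R / 8) z.
  by move=> /in_boxP h; apply/in_boxP => j /h h1; apply: le_trans h1 R64.
(* Degenerate case of constant [iota]: either [B] is empty or [W] has no small positive element. *)
have triv : {in B &, forall x y, iota x <= iota y} -> exists phi : V -> nat,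
    [/\ {in B &, forall x y, iota x < iota y -> (phi x < phi y)%N},
        {in B, forall x, (phi x < #|` W|)%N} &
        forall v, exists2 L : seq nat, (size L <= 2 ^ size s)%N &
          {in B &, forall x y, x + y = v -> (phi x + phi y)%N \in L}].
  move=> cst; exists (fun=> 0%N); split.
  - by move=> x y xB yB; rewrite ltNge cst.
  - by move=> x _; rewrite cardfs_gt0; apply/fset0Pn; exists 0.
  - move=> v; exists [:: 0%N]; first by rewrite expn_gt0.
    by move=> x y _ _ _; rewrite addn0 mem_head.
have [B0|/fset0Pn[x0 x0B]] := eqVneq B fset0; first by apply: triv => x y; rewrite B0.
pose posbox x := in_box c s (R / 8) x && (0 < iota x).
have [|noposW] := boolP (has posbox (enum_fset W)); last first.
  apply: triv => x y xB yB; rewrite leNgt; apply: contra noposW => lt_yx.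
  have [xyW /box8 xybox] := BW x y xB yB.
  by apply/hasP; exists (x - y); rewrite // /posbox xybox linearB subr_gt0.
move=> /hasP exu.
have [u [uW /andP[ubox u0] umin]] : exists u : V, [/\ u \in W,
    in_box c s (R / 8) u && (0 < iota u) & {in W, forall x : V,
    in_box c s (R / 8) x && (0 < iota x) -> iota u <= iota x}].
  exact: exists_min_fset.
have {}umin : {in W, forall x, in_box c s (R / 8) x -> 0 < iota x -> iota u <= iota x}.
  by move=> x xW xbox h; apply: umin; rewrite // xbox.
have [i0 i0s ci0] := local_group_escape Wlg uW u0.
have [i i_s imax] := exists_max_seq (fun j => `|c j u|) i0s.
have ciu0 : c i u != 0.
  by rewrite -normr_gt0; apply: lt_le_trans (imax _ i0s); rewrite normr_gt0.
pose s' := rem i s.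
have ss' : size s = (size s').+1 by rewrite /s' size_rem // prednK //; case: (s) i_s.
pose p := slide c u i; pose tau := slope c u i.
have boxp r x : 0 <= r -> in_box c s' r (p x) -> in_box c s r (p x).
  move=> r0 /in_boxP h; apply/in_boxP => j.
  rewrite (perm_mem (perm_to_rem i_s)) inE => /predU1P[->|/h//].
  by rewrite /p c_slide // normr0.
(* Only inside the [R / 16] box does [slide_rep] supply short representatives. *)
pose W' := [fset p x | x in W & in_box c s' (R / 16) (p x)].
have W'P x : x \in W' -> exists2 y, y \in W & p y = x /\ in_box c s (R / 16) x.
  move=> /imfsetP[y /=]; rewrite inE => /andP[yW ybox] ->; exists y => //.
  by split=> //; apply: boxp; rewrite // divr_ge0 // ltW.
have inW' x : x \in W -> in_box c s' (R / 16) (p x) -> p x \in W'.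
  by move=> xW xbox; apply/imfsetP; exists x; rewrite //= inE xW.
have subbox r x : in_box c s r x -> in_box c s' r x.
  move=> /in_boxP h; apply/in_boxP => j js'; apply: h; exact: mem_rem js'.
have W'lg : local_group c s' (R / 16) W'.
  split.
  - rewrite -(slide0 c u i); apply: inW' => //; rewrite /p slide0.
    by apply/in_boxP => j _; rewrite linear0 normr0 divr_ge0 // ltW.
  - by move=> x /W'P[_ _ [_ /subbox]].
  - move=> x /W'P[y yW [<- ybox]]; rewrite -slideN; apply: inW'; first exact: WN.
    apply: subbox; apply/in_boxP => j js; rewrite /p slideN linearN normrN.
    exact: (in_boxP _ _ _ _ ybox).
  - move=> x y /W'P[x1 x1W [<- xbox]] /W'P[y1 y1W [<- ybox]].
    rewrite -slideD => xybox.
    have [|z zW ez] := slide_sum R0 Wlg uW ubox ciu0 x1W y1W xbox ybox.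
      by apply: boxp; rewrite // divr_ge0 // ltW.
    by rewrite -ez; apply: inW'; rewrite // /p ez.
have W'inj : {in W', forall x, iota x = 0 -> x = 0}.
  move=> x /W'P[y yW [<- ybox]].
  exact: (slide_iota_inj R0 Wlg iota_inj uW ubox u0 umin ciu0 yW ybox).
pose r := lex_radius (size s).
have r0 : 0 < r := lex_radius_gt0 _.
have rs' : lex_radius (size s') = 32 * r by rewrite /r ss' -lex_radiusS.
have r64 : 32 * r <= 1 / 64 by rewrite -rs' lex_radius_le.
have pbox z : in_box c s (r * R) z -> in_box c s (2 * (r * R)) (p z).
  move=> zbox; apply/in_boxP => j js.
  rewrite /p /slide linearB linearZ /=; apply: le_trans (ler_normB _ _) _.
  have := slope_bound i_s ciu0 imax zbox js; have := in_boxP _ _ _ _ zbox _ js.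
  lra.
pose B' := [fset p x | x in B].
have pB' x : x \in B -> p x \in B' by move=> xB; apply/imfsetP; exists x.
have B'W' : {in B' &, forall x y, x - y \in W' /\
    in_box c s' (lex_radius (size s') * (R / 16)) (x - y)}.
  move=> _ _ /imfsetP[x /= xB ->] /imfsetP[y /= yB ->].
  have [xyW xybox] := BW x y xB yB.
  have h : in_box c s' (lex_radius (size s') * (R / 16)) (p (x - y)).
    rewrite rs' (_ : _ * _ = 2 * (r * R)); last by field.
    exact: subbox (pbox _ xybox).
  rewrite -slideB; split => //; apply: inW' => //.
  apply/in_boxP => j js; apply: le_trans (in_boxP _ _ _ _ h _ js) _.
  by rewrite rs'; nra.
have [||phi [phi_mono phi_lt phi_sum]] := IHd s' (R / 16) W' B' _ _ W'lg W'inj B'W'.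
- by move: ltsd; rewrite ss'.
- by rewrite divr_gt0.
pose h := Num.truncn (R / (2 * `|c i u|)).
(* [T] bounds the slopes of differences in [B]. Shifting by [T] makes [a] nonnegative, and [2 * T]
   is at most [R / (2 |c i u|)], so digits never exceed [h]. *)
pose T := r * R / `|c i u|.
pose a x := tau x - tau x0 + T.
have aP x : x \in B -> 0 <= a x <= 2 * T.
  move=> xB; have [_ /in_boxP/(_ i i_s)] := BW x x0 xB x0B.
  rewrite /a -slopeB // /slope -/r => hc.
  have : `|c i (x - x0) / c i u| <= T.
    by rewrite normrM normfV ler_pM2r // invr_gt0 normr_gt0.
  by move=> /ler_normlP[h1 h2]; apply/andP; split; lra.
pose dig x := Num.truncn (a x).
have digh x : x \in B -> (dig x <= h)%N.
  move=> xB; have /andP[a0 a1] := aP x xB.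
  apply: le_truncn; apply: le_trans a1 _.
  rewrite /T invfM !mulrA ler_pM2r ?invr_gt0 ?normr_gt0 //.
  by nra.
exists (fun x => phi (p x) * h.+1 + dig x)%N; split.
- move=> x y xB yB ltxy.
  have [yxW yxbox] := BW y x yB xB.
  have yx0 : 0 < iota (y - x) by rewrite linearB subr_gt0.
  have [pyx|pyx] := eqVneq (p (y - x)) 0.
    have : 1 <= tau (y - x).
      apply: (slope_ge1 R0 u0 umin _ yxW yxbox yx0 pyx).
      by have := lex_radius_le (size s); lra.
    move/eqP: pyx; rewrite /p slideB subr_eq0 => /eqP ->.
    rewrite /tau slopeB ltn_add2l => h1.
    have /andP[ax0 _] := aP x xB; have /andP[ay0 _] := aP y yB.
    have /andP[h2 _] := truncn_itv ax0.
    rewrite -/(dig x) in h2.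
    rewrite /dig truncn_ge_nat // -natr1 -/(dig x).
    by apply: le_trans (lerD h2 h1) _; rewrite /a /tau; lra.
  have := slide_mono R0 Wlg iota_inj uW u0 umin i_s ciu0 imax
    (lex_radius_le _) yxW yxbox yx0 pyx.
  rewrite slideB linearB subr_gt0 => /(phi_mono _ _ (pB' _ xB) (pB' _ yB)) lt.
  apply: (@leq_trans ((phi (p x)).+1 * h.+1)%N).
    by rewrite mulSn addnC ltn_add2r ltnS digh.
  by apply: leq_trans (leq_addr _ _); rewrite leq_mul2r lt orbT.
- move=> x xB; apply: (@leq_trans ((phi (p x)).+1 * h.+1)%N).
    by rewrite mulSn addnC ltn_add2r ltnS digh.
  apply: (@leq_trans (#|` W'| * h.+1)%N); first by rewrite leq_mul2r phi_lt ?orbT ?pB'.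
  exact: (card_slide R0 Wlg uW ubox u0 ciu0 imax W'P).
- move=> v; have [L sL LP] := phi_sum (p v).
  (* The sum [a x + a y] depends only on [v], so the digits sum to [t] or [t.-1]. *)
  pose t := Num.truncn (tau v - 2 * tau x0 + 2 * T).
  exists [seq l * h.+1 + m | l <- L, m <- [:: t; t.-1]]%N.
    by rewrite size_allpairs ss' expnS mulnC leq_mul2l sL orbT.
  move=> x y xB yB exy; apply/allpairsPdep.
  exists (phi (p x) + phi (p y))%N, (dig x + dig y)%N; split; last by rewrite mulnDl addnACA.
    by apply: LP; rewrite ?pB' // -slideD exy.
  have /andP[ax0 _] := aP x xB; have /andP[ay0 _] := aP y yB.
  have := truncn_pair ax0 ay0.
  have -> // : a x + a y = tau v - 2 * tau x0 + 2 * T.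
  by rewrite -exy /tau slopeD /a /tau; lra.
Qed.
End LexEnumeration.

(** * The Pluennecke and Ruzsa inequalities *)

Section Sumsets.
Implicit Types (A B C X Y Z : {fset int}).

Lemma sumsetP A B x :
  reflect (exists2 a, a \in A & exists2 b, b \in B & x = a + b) (x \in sumset A B).
Proof. exact: imfset2P. Qed.

Lemma mem_sumset A B a b : a \in A -> b \in B -> a + b \in sumset A B.
Proof. by move=> aA bB; apply/sumsetP; exists a => //; exists b. Qed.

Definition oppset A : {fset int} := [fset - a | a in A].

Lemma mem_oppset A a : a \in A -> - a \in oppset A.
Proof. by move=> aA; apply/imfsetP; exists a. Qed.

Lemma sumset0r A : sumset A fset0 = fset0.
Proof. by apply/fsetP => x; rewrite inE; apply/sumsetP => -[a _ [b]]; rewrite inE. Qed.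

Lemma sumsetA A B C : sumset A (sumset B C) = sumset (sumset A B) C.
Proof.
apply/fsetP => x; apply/sumsetP/sumsetP.
  move=> [a aA [_ /sumsetP[b bB [c cC ->]] ->]].
  by exists (a + b); [exact: mem_sumset|exists c; rewrite ?addrA].
move=> [_ /sumsetP[a aA [b bB ->]] [c cC ->]].
by exists a => //; exists (b + c); [exact: mem_sumset|rewrite addrA].
Qed.

(** Petridis's lemma; the hypothesis says that [X] minimises |Z + A| / |Z| over its subsets. Let [Z]
    consist of the [x] for which [x + A + c] is already covered. Adding [c] to [C'] enlarges
    [X + A + C'] by at most |X + A| - |Z + A| and [X + C'] by at least |X| - |Z|; minimality
    compares the two gains. *)
Lemma petridis X A C :
  (forall Z, Z `<=` X -> (#|` sumset X A| * #|` Z| <= #|` sumset Z A| * #|` X|)%N) ->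
  (#|` sumset (sumset X A) C| * #|` X| <= #|` sumset X A| * #|` sumset X C|)%N.
Proof.
move=> Xmin; have [n] := ubnP #|` C|; elim: n C => // n IHn C ltCn.
have [->|/fset0Pn[c cC]] := eqVneq C fset0; first by rewrite !sumset0r cardfs0.
pose C' := C `\ c.
have C'E : #|` C| = #|` C'|.+1 by rewrite (cardfsD1 c) cC.
have C'C x : x \in C' -> x \in C by rewrite inE => /andP[].
pose Z := [fset x in X | [forall a : A, x + fsval a + c \in sumset (sumset X A) C']].
have ZX : Z `<=` X by apply/fsubsetP => x; rewrite inE => /andP[].
have ZP x a : x \in Z -> a \in A -> x + a + c \in sumset (sumset X A) C'.
  by rewrite inE => /andP[_ /forallP h] aA; exact: (h [` aA]).
have up : (#|` sumset (sumset X A) C| <=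
    #|` sumset (sumset X A) C'| + (#|` sumset X A| - #|` sumset Z A|))%N.
  have ZXA : sumset Z A `<=` sumset X A.
    apply/fsubsetP => x /sumsetP[z zZ [a aA ->]].
    by apply: mem_sumset aA; exact: (fsubsetP ZX).
  rewrite -cardfsDS //; set D := _ `\` _.
  apply: (@leq_trans #|` sumset (sumset X A) C' `|` [fset y + c | y in D]|).
    apply/fsubset_leq_card/fsubsetP => _ /sumsetP[y yXA [d dC ->]].
    rewrite in_fsetU; have [dc|dc] := eqVneq d c; last first.
      by rewrite mem_sumset // !inE dc.
    have [yZA|yZA] := boolP (y \in sumset Z A).
      by move/sumsetP: yZA => [z zZ [a aA ->]]; rewrite dc ZP.
    by apply/orP; right; apply/imfsetP; exists y; rewrite ?dc //= /D in_fsetD yZA.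
  by rewrite cardfsU (leq_trans (leq_subr _ _)) // leq_add2l leq_imfset_card.
have low : (#|` sumset X C'| + (#|` X| - #|` Z|) <= #|` sumset X C|)%N.
  rewrite -cardfsDS //; pose D := [fset x + c | x in X `\` Z].
  have <- : #|` D| = #|` X `\` Z| by rewrite card_imfset //; exact: addIr.
  (* If [x + c] were in [X + C'], adding any [a] would put [x + a + c] in [X + A + C'], so [x] would
     belong to [Z]. *)
  have dis : sumset X C' `&` D = fset0.
    apply/fsetP => y; rewrite in_fsetI [RHS]inE; apply/negbTE/negP.
    move=> /andP[yXC' /imfsetP[x /=]]; rewrite in_fsetD => /andP[/negP xZ xX] exy.
    apply: xZ; rewrite !inE xX /=; apply/forallP => a.
    rewrite addrAC -exy; move/sumsetP: yXC' => [x' x'X [d dC' ->]].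
    by rewrite addrAC mem_sumset // mem_sumset // fsvalP.
  rewrite -cardfsUI dis cardfs0 addn0.
  apply/fsubset_leq_card/fsubsetP => y; rewrite in_fsetU.
  move=> /orP[/sumsetP[x xX [d /C'C dC ->]]|].
    exact: mem_sumset.
  by move=> /imfsetP[x /=]; rewrite in_fsetD => /andP[_ xX] ->; exact: mem_sumset.
have IH : (#|` sumset (sumset X A) C'| * #|` X| <= #|` sumset X A| * #|` sumset X C'|)%N.
  by apply: IHn; rewrite C'E in ltCn.
have zx := fsubset_leq_card ZX; have := Xmin Z ZX.
move: up low IH zx.
move: (#|` sumset (sumset X A) C|) (#|` sumset (sumset X A) C'|).
move: (#|` sumset X C|) (#|` sumset X C'|).
move: (#|` sumset X A|) (#|` sumset Z A|) (#|` X|) (#|` Z|) => xa za x z a b d e.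
nia.
Qed.

Fixpoint nfold n A : {fset int} := if n is n'.+1 then sumset A (nfold n' A) else [fset 0].

Lemma mem_nfold n A (s : seq int) :
  size s = n -> {subset s <= A} -> \sum_(x <- s) x \in nfold n A.
Proof.
move=> <- {n}; elim: s => [|a s IHs] sA /=; first by rewrite big_nil inE.
rewrite big_cons mem_sumset ?sA ?mem_head // IHs // => x xs.
by rewrite sA // inE xs orbT.
Qed.

(** Fix for each [d] in [Y - Z] a representation [d = y - z]. The map sending [(x, d)] to
    [(x + y, x + z)] is injective, since the difference of the components recovers [d]. *)
Lemma ruzsa_triangle X Y Z :
  (#|` X| * #|` sumset Y (oppset Z)| <= #|` sumset X Y| * #|` sumset X Z|)%N.
Proof.
have dP d : exists yz : int * int, (d \in sumset Y (oppset Z)) ==>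
    [&& yz.1 \in Y, yz.2 \in Z & d == yz.1 - yz.2].
  case: (boolP (_ \in _)) => [/sumsetP[y yY [_ /imfsetP[z /= zZ ->] ->]]|_].
    by exists (y, z); rewrite /= yY zZ eqxx.
  by exists (0, 0).
pose f d := xchoose (dP d).
have fP d : d \in sumset Y (oppset Z) ->
    [/\ (f d).1 \in Y, (f d).2 \in Z & d = (f d).1 - (f d).2].
  by move=> dYZ; have /implyP/(_ dYZ)/and3P[? ? /eqP] := xchooseP (dP d).
rewrite -(size_allpairs (fun x d => (x + (f d).1, x + (f d).2))) -(size_allpairs pair).
apply: uniq_leq_size.
  apply: allpairs_uniq; rewrite ?fset_uniq //.
  move=> [x d] [x' d'] /allpairsPdep[x1 [d1 [_ d1YZ [-> ->]]]] {x d}.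
  move=> /allpairsPdep[x2 [d2 [_ d2YZ [-> ->]]]] {x' d'} /= [e1 e2].
  have [_ _ ed1] := fP _ d1YZ; have [_ _ ed2] := fP _ d2YZ.
  have ed : d1 = d2.
    move: ed1 ed2 e1 e2; move: (f d1).1 (f d1).2 (f d2).1 (f d2).2 => a b a' b'; lia.
  by move: e1; rewrite ed => /addIr ->.
move=> _ /allpairsPdep[x [d [xX /fP[yY zZ _] ->]]].
by apply/allpairsPdep; exists (x + (f d).1), (x + (f d).2); split; rewrite ?mem_sumset.
Qed.

(** Take a nonempty [X] in [A] minimising |X + A| / |X|. Iterating [petridis] gives |X + jA| <= k^j
    |X|, and the triangle inequality through [X] passes to [nA - mA]. *)
Lemma plunnecke A k n m : A != fset0 -> (#|` sumset A A| <= k * #|` A|)%N ->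
  (#|` sumset (nfold n A) (oppset (nfold m A))| <= k ^ (n + m) * #|` A|)%N.
Proof.
move=> A0 AA.
pose f X : rat := #|` sumset X A|%:R / #|` X|%:R.
have [X [_ /andP[X0 XA] Xmin]] : exists X, [/\ X \in fpowerset A,
    (X != fset0) && (X `<=` A) & {in fpowerset A, forall Y,
    (Y != fset0) && (Y `<=` A) -> f X <= f Y}].
  by apply: exists_min_fset; exists A; rewrite ?fpowersetE ?A0 fsubset_refl.
have cX : (0 < #|` X|)%N by rewrite cardfs_gt0.
have cA : (0 < #|` A|)%N by rewrite cardfs_gt0.
have XAk : (#|` sumset X A| <= k * #|` X|)%N.
  have := Xmin A; rewrite fpowersetE A0 fsubset_refl => /(_ isT isT).
  rewrite /f ler_pdivrMr ?ltr0n // mulrAC ler_pdivlMr ?ltr0n // -!natrM ler_nat.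
  move=> h; rewrite -(leq_pmul2r cA); apply: leq_trans h _.
  by rewrite mulnAC leq_mul2r AA orbT.
have XP Z : Z `<=` X -> (#|` sumset X A| * #|` Z| <= #|` sumset Z A| * #|` X|)%N.
  move=> ZX; have [->|Z0] := eqVneq Z fset0; first by rewrite cardfs0 muln0.
  have cZ : (0 < #|` Z|)%N by rewrite cardfs_gt0.
  have ZA := fsubset_trans ZX XA.
  have := Xmin Z; rewrite fpowersetE Z0 ZA => /(_ isT isT).
  by rewrite /f ler_pdivrMr ?ltr0n // mulrAC ler_pdivlMr ?ltr0n // -!natrM ler_nat.
have Xn j : (#|` sumset X (nfold j A)| <= k ^ j * #|` X|)%N.
  elim: j => [|j IHj] /=.
    rewrite mul1n; apply: (@leq_trans #|` [fset x + 0 | x in X]|); last exact: leq_imfset_card.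
    apply/fsubset_leq_card/fsubsetP => _ /sumsetP[x xX [y y0 ->]].
    by move: y0; rewrite inE => /eqP ->; apply/imfsetP; exists x.
  rewrite sumsetA -(leq_pmul2r cX); apply: leq_trans (petridis _ XP) _.
  apply: leq_trans (leq_mul XAk IHj) _.
  by rewrite expnS mulnACA !mulnA.
rewrite -(leq_pmul2l cX); apply: leq_trans (ruzsa_triangle _ _ _) _.
apply: leq_trans (leq_mul (Xn n) (Xn m)) _.
rewrite expnD mulnACA mulnCA leq_mul2l; apply/orP; right.
by rewrite leq_mul2l fsubset_leq_card ?orbT.
Qed.
End Sumsets.

(** * Ruzsa's model lemma *)

Lemma fset_pigeonhole (T : choiceType) (J : eqType) (A : {fset T}) (f : T -> J) (r : seq J) :
  A != fset0 -> {in A, forall a, f a \in r} ->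
  exists j, (#|` A| <= size r * #|` [fset a in A | f a == j]|)%N.
Proof.
move=> /fset0Pn[a0 a0A] fr.
have [j _ jmax] := exists_max_seq (fun j => #|` [fset a in A | f a == j]|) (fr _ a0A).
exists j.
have cover (r' : seq J) :
    (#|` [fset a in A | f a \in r']| <= \sum_(i <- r') #|` [fset a in A | f a == i]|)%N.
  elim: r' => [|i r' IHr].
    by rewrite big_nil leqn0 cardfs_eq0; apply/eqP/fsetP => x; rewrite !inE andbF.
  rewrite big_cons; apply: leq_trans (leq_add (leqnn _) IHr).
  rewrite -cardfsUI; apply: leq_trans (leq_addr _ _).
  apply/fsubset_leq_card/fsubsetP => x; rewrite !inE => /andP[-> /= /orP[->|->]] //.
  by rewrite orbT.
have -> : A = [fset a in A | f a \in r].
  by apply/fsetP => x; rewrite !inE andb_idr //; exact: fr.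
apply: leq_trans (cover r) _.
rewrite -sum1_size big_distrl /= big_seq [leqRHS]big_seq.
apply: leq_sum => i ir; rewrite mul1n.
have -> : [fset a in [fset a in A | f a \in r] | f a == j] = [fset a in A | f a == j].
  by apply/fsetP => x; rewrite !inE; case: (boolP (x \in A)) => // /fr ->.
exact: jmax.
Qed.

(* Each pair (d, v) excludes at most one l modulo p, and (-p, p) contains at most
   2 (p - 1) / N nonzero multiples v of N. *)
Lemma exists_multiplier (D : {fset int}) (N p : nat) : prime p -> (2 * #|` D| < N)%N ->
  {in D, forall d, `|d| < p}%N ->
  exists l : nat, forall d v : int, d \in D -> d != 0 -> (`|v| < p)%N ->
    (p %| l%:Z * d - v)%Z -> (N %| v)%Z -> False.
Proof.
move=> pp DN Dp; have p1 := prime_gt1 pp.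
have pdvd (m : int) (l l' : nat) (d : int) : (l < p)%N -> (l' < p)%N -> d \in D -> d != 0 ->
    (p %| l%:Z * d - m)%Z -> (p %| l'%:Z * d - m)%Z -> l = l'.
  move=> lp l'p dD d0 h h'.
  have : (p %| (l%:Z - l'%:Z) * d)%Z.
    have -> : (l%:Z - l'%:Z) * d = (l%:Z * d - m) - (l'%:Z * d - m) by ring.
    exact: rpredB.
  rewrite !dvdzE abszM Euclid_dvdM // => /orP[|]; last first.
    by move=> /dvdn_leq; have := Dp d dD; lia.
  by move=> /dvdn_leq; lia.
pose J := (p.-1 %/ N)%N.
pose js := [seq k%:Z | k <- iota 1 J] ++ [seq - k%:Z | k <- iota 1 J].
pose L := [seq (d, j) | d <- enum_fset D, j <- js].
pose bad (l : nat) (dj : int * int) := (dj.1 != 0) && (p %| l%:Z * dj.1 - N%:Z * dj.2)%Z.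
have [/hasP[l]|/hasPn allbad] := boolP (has (fun l => ~~ has (bad l) L) (iota 1 p.-1)).
  rewrite mem_iota => /andP[l0 lp] /hasPn lgood; exists l => d v dD d0 vp pv /dvdzP[j ej].
  have j0 : j != 0.
    apply: contra d0 => /eqP j0; move: pv; rewrite ej j0 mul0r => pv.
    rewrite -(negbK (d == 0)); apply/negP => d0.
    (* The multiplier 0 also solves the congruence with value 0, so uniqueness would give
       [l = 0]. *)
    have := pdvd 0 l 0%N d _ _ dD d0 pv; rewrite mul0r subrr dvdz0.
    by move=> /(_ _ _ isT); lia.
  have jJ : (`|j| <= J)%N.
    by rewrite /J leq_divRL; [move: vp; rewrite ej abszM; lia | lia].
  have : (d, j) \in L.
    apply/allpairsPdep; exists d, j; split=> //; rewrite mem_cat.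
    apply/orP; case: (lerP 0 j) => hj; [left|right]; apply/mapP; exists `|j|%N.
    - by rewrite mem_iota; lia.
    - lia.
    - by rewrite mem_iota; lia.
    - lia.
  by move=> /lgood; rewrite /bad /= d0 (_ : N%:Z * j = v) ?pv // ej mulrC.
have := @uniq_leq_size _ [seq nth (0, 0) L (find (bad l) L) | l <- iota 1 p.-1] L.
rewrite size_map size_iota size_allpairs => h.
have {h} : (p.-1 <= #|` D| * size js)%N.
  apply: h.
    rewrite map_inj_in_uniq ?iota_uniq // => l l'.
    rewrite !mem_iota => lP l'P e.
    have /negbNE hl : ~~ ~~ has (bad l) L by apply: allbad; rewrite mem_iota.
    have /negbNE hl' : ~~ ~~ has (bad l') L by apply: allbad; rewrite mem_iota.
    have /andP[d0 b] := nth_find (0, 0) hl; have /andP[_ b'] := nth_find (0, 0) hl'.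
    rewrite -e in b'.
    have : nth (0, 0) L (find (bad l) L) \in L by rewrite mem_nth -?has_find.
    move: d0 b b'; case: (nth _ _ _) => d j /= d0 b b' /allpairsPdep[d1 [j1 [dD _ [ed _]]]].
    by apply: (pdvd _ _ _ _ _ _ _ d0 b b'); rewrite ?ed //; lia.
  move=> _ /mapP[l lP ->].
  have /negbNE hl : ~~ ~~ has (bad l) L by apply: allbad.
  by rewrite mem_nth // -has_find.
rewrite size_cat !size_map size_iota.
have : (J * N <= p.-1)%N by rewrite /J leq_divM.
move: (#|` D|) DN (J) => m mN j h1 h2; nia.
Qed.

(** [th] is multiplication by [l] modulo [p], and [A1] is the part of [A] whose residues fall in one
    well-populated interval of length [p / s]. Sums of [s] residues then differ by less than [p], so
    congruence modulo [p] becomes equality; the choice of [l] excludes a nonzero difference whose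
    residue is a multiple of [N]. *)
Lemma ruzsa_model (A : {fset int}) (s N : nat) : A != fset0 -> (0 < s)%N ->
  (2 * #|` sumset (nfold s A) (oppset (nfold s A))| < N)%N ->
  exists (A1 : {fset int}) (th : int -> int),
    [/\ A1 `<=` A, (#|` A| <= s * #|` A1|)%N &
      forall u v : seq int, size u = s -> size v = s -> {subset u <= A1} -> {subset v <= A1} ->
        (\sum_(a <- u) a = \sum_(a <- v) a -> \sum_(a <- u) th a = \sum_(a <- v) th a) /\
        ((N %| \sum_(a <- u) th a - \sum_(a <- v) th a)%Z -> \sum_(a <- u) a = \sum_(a <- v) a)].
Proof.
move=> A0 s0; set D := sumset _ _ => DN.
have [p pD pp] := prime_above (\sum_(d <- enum_fset D) `|d|)%N.
have Dp : {in D, forall d, `|d| < p}%N.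
  by move=> d dD; apply: leq_ltn_trans pD; rewrite (big_rem d) //= leq_addr.
have p0 : (0 < p)%N := prime_gt0 pp.
have [l lP] := exists_multiplier pp DN Dp.
pose th (a : int) := ((l%:Z * a) %% p)%Z.
have th0 a : 0 <= th a by rewrite modz_ge0 //; lia.
have thp a : th a < p by rewrite ltz_pmod //; lia.
pose f a := (s%:Z * th a %/ p)%Z.
have fr : {in A, forall a, f a \in [seq j%:Z | j <- iota 0 s]}.
  move=> a _; have f0 : 0 <= f a by rewrite divz_ge0 ?mulr_ge0 //; lia.
  have fs : f a < s by rewrite ltz_divLR ?ltr_pM2l //; lia.
  by apply/mapP; exists `|f a|%N; [rewrite mem_iota; lia | lia].
have [j] := fset_pigeonhole A0 fr; rewrite size_map size_iota.
set A1 := [fset _ in _ | _] => cA1.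
have A1A : A1 `<=` A by apply/fsubsetP => a; rewrite !inE => /andP[].
exists A1, th; split => // u v su sv uA vA.
(* The term [size w] records strict upper bounds; it makes two sums of [s] residues differ by
   strictly less than [p]. *)
have range (w : seq int) : {subset w <= A1} ->
    j * p * size w <= s%:Z * (\sum_(a <- w) th a) /\
    s%:Z * (\sum_(a <- w) th a) + size w <= (j + 1) * p * size w.
  elim: w => [|a w IHw] wA; first by rewrite big_nil /=; lia.
  have aA : a \in A1 by rewrite wA // mem_head.
  have [|h1 h2] := IHw; first by move=> b bw; rewrite wA // inE bw orbT.
  have := aA; rewrite !inE => /andP[_ /eqP fa].
  have := divz_eq (s%:Z * th a) p; rewrite -/(f a) fa => e.
  have m0 : 0 <= (s%:Z * th a %% p)%Z by rewrite modz_ge0 //; lia.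
  have mp : (s%:Z * th a %% p)%Z < p by rewrite ltz_pmod //; lia.
  rewrite big_cons /= mulrDr e; move: h1 h2.
  move: (\sum_(_ <- _) _) ((_ %% p)%Z) m0 mp => S m m0 mp; nia.
have [u1 u2] := range u uA; have [v1 v2] := range v vA.
have congr_th (w : seq int) : (p %| l%:Z * (\sum_(a <- w) a) - \sum_(a <- w) th a)%Z.
  rewrite mulr_sumr -sumrB; apply: rpred_sum => a _.
  by apply/dvdzP; exists (l%:Z * a %/ p)%Z; have := divz_eq (l%:Z * a) p; rewrite /th; lia.
set d := \sum_(a <- u) a - \sum_(a <- v) a.
set V := \sum_(a <- u) th a - \sum_(a <- v) th a.
have Vp : (`|V| < p)%N.
  rewrite /V; move: u1 u2 v1 v2; rewrite su sv.
  move: (\sum_(a <- u) th a) (\sum_(a <- v) th a) => x y.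
  nia.
have dD : d \in D.
  apply: mem_sumset; first by apply: mem_nfold => // x /uA; apply/fsubsetP.
  by apply/mem_oppset/mem_nfold => // x /vA; apply/fsubsetP.
have pV : (p %| l%:Z * d - V)%Z.
  have -> : l%:Z * d - V = (l%:Z * (\sum_(a <- u) a) - \sum_(a <- u) th a)
    - (l%:Z * (\sum_(a <- v) a) - \sum_(a <- v) th a) by rewrite /d /V; ring.
  exact: rpredB.
split=> [e|NV].
  apply/eqP; rewrite -subr_eq0 -/V -absz_eq0; apply/eqP.
  move: pV; rewrite /d e subrr mulr0 sub0r dvdzE abszN /=.
  by case: (posnP `|V|%N) => // V0 /dvdn_leq -/(_ V0); lia.
apply/eqP; rewrite -subr_eq0; apply/negPn/negP => d0.
exact: (lP d V).
Qed.

(** * Bogolyubov's lemma *)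

Section Fourier.
Variables (R : realType) (N : nat).
Hypothesis N0 : (0 < N)%N.
Implicit Types (k l t x : int) (X : seq int).

(** [wcos] and [wsin] are the real and imaginary parts of the standard additive character modulo
    [N]. *)
Definition angle k : R := pi *+ 2 * k%:~R / N%:R.
Definition wcos k : R := cos (angle k).
Definition wsin k : R := sin (angle k).

Lemma wcosD k l : wcos (k + l) = wcos k * wcos l - wsin k * wsin l.
Proof. by rewrite /wcos /wsin -cosD /angle intrD mulrDr mulrDl. Qed.

Lemma wsinD k l : wsin (k + l) = wsin k * wcos l + wcos k * wsin l.
Proof. by rewrite /wcos /wsin -sinD /angle intrD mulrDr mulrDl. Qed.

Lemma wcosN k : wcos (- k) = wcos k.
Proof. by rewrite /wcos /angle mulrNz mulrN mulNr cosN. Qed.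

Lemma wsinN k : wsin (- k) = - wsin k.
Proof. by rewrite /wsin /angle mulrNz mulrN mulNr sinN. Qed.

Lemma wcos0 : wcos 0 = 1.
Proof. by rewrite /wcos /angle mulr0 mul0r cos0. Qed.

Lemma wsin0 : wsin 0 = 0.
Proof. by rewrite /wsin /angle mulr0 mul0r sin0. Qed.

Lemma angleN : angle N = pi *+ 2.
Proof. by rewrite /angle -pmulrn mulfK // pnatr_eq0 -lt0n. Qed.

Lemma wcos_dvd k : (N %| k)%Z -> wcos k = 1 /\ wsin k = 0.
Proof.
move=> /dvdzP[q ->].
have h (m : nat) : wcos (m%:Z * N) = 1 /\ wsin (m%:Z * N) = 0.
  elim: m => [|m [c s]]; first by rewrite mul0r wcos0 wsin0.
  have -> : m.+1%:Z * N = m%:Z * N + N by lia.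
  rewrite wcosD wsinD c s /wcos /wsin angleN cos2pi sin2pi.
  by split; ring.
case: q => m; first exact: h.
by rewrite NegzE mulNr wcosN wsinN; have [-> ->] := h m.+1; rewrite oppr0.
Qed.

Lemma wcos_mod k l : (N %| k - l)%Z -> wcos k = wcos l.
Proof.
move=> /wcos_dvd[c s]; have -> : k = (k - l) + l by lia.
by rewrite wcosD c s; ring.
Qed.

Lemma wcos_ge0 k : (4 * `|k| <= N)%N -> 0 <= wcos k.
Proof.
move=> kN; apply: cos_ge0_pihalf.
have N0' : 0 < N%:R :> R by rewrite ltr0n.
have : 4 * `|k%:~R : R| <= N%:R by rewrite -intr_norm -abszE -pmulrn -natrM ler_nat.
move=> /(ler_wpM2l (pi_ge0 R)) h.
have : `|angle k| <= pi / 2.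
  rewrite /angle normrM normfV (ger0_norm (ltW N0')) ler_pdivrMr // normrM.
  have p2 : 0 <= pi *+ 2 :> R by have := pi_ge0 R; lra.
  by rewrite (ger0_norm p2); lra.
by rewrite ler_norml.
Qed.

(** For a nonzero residue, half the angle lies strictly between 0 and pi, where the sine is
    positive; the double-angle formula then gives a cosine below 1. *)
Lemma wcos_eq1 k : wcos k = 1 -> (N %| k)%Z.
Proof.
rewrite (@wcos_mod k (k %% N)%Z); last first.
  by apply/dvdzP; exists (k %/ N)%Z; have := divz_eq k N; lia.
have r0 : 0 <= (k %% N)%Z by rewrite modz_ge0 // -lt0n.
have rN : (k %% N)%Z < N by rewrite ltz_pmod // ltz_nat.
move=> c1; apply/dvdz_mod0P; apply/eqP; rewrite eq_le r0 andbT leNgt; apply/negP => rpos.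
have N0' : 0 < N%:R :> R by rewrite ltr0n.
pose th : R := pi * (k %% N)%Z%:~R / N%:R.
have : 0 < sin th.
  apply: sin_gt0_pi; rewrite /th divr_gt0 ?mulr_gt0 ?pi_gt0 ?ltr0z //=.
  rewrite ltr_pdivrMr // ltr_pM2l ?pi_gt0 //.
  by rewrite (_ : N%:R = (N%:Z)%:~R) ?ltr_int // -pmulrn.
move: c1; rewrite /wcos (_ : angle _ = th *+ 2); last first.
  by rewrite /angle /th !mulrnAl.
rewrite cos_mulr2n; have := cos2Dsin2 th; move: (cos th) (sin th) => a b h1 h2 h3.
have : 0 < b ^+ 2 by rewrite exprn_gt0.
lra.
Qed.

(** Shifting [g] by 1 permutes the frequencies and rotates the vector [(P, Q)] by the angle of [k];
    a vector fixed by a nontrivial rotation vanishes. *)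
Lemma wcos_sum k : \sum_(g < N) wcos (g%:Z * k) = if (N %| k)%Z then N%:R else 0.
Proof.
case: ifPn => [Nk|Nk].
  rewrite (eq_bigr (fun=> 1)) ?sumr_const ?card_ord // => g _.
  by have [->] := wcos_dvd (dvdz_mull g%:Z Nk).
pose P := \sum_(g < N) wcos (g%:Z * k); pose Q := \sum_(g < N) wsin (g%:Z * k).
have shift (f : int -> R) : f (N%:Z * k) = f 0 ->
    \sum_(g < N) f (g%:Z * k + k) = \sum_(g < N) f (g%:Z * k).
  move=> fN; rewrite -(big_mkord xpredT (fun g => f (g%:Z * k))).
  rewrite -(big_mkord xpredT (fun g => f (g%:Z * k + k))).
  have -> : \sum_(0 <= g < N) f (g%:Z * k + k) = \sum_(1 <= g < N.+1) f (g%:Z * k).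
    by rewrite big_add1 /=; apply: eq_bigr => g _; congr f; lia.
  apply: (addrI (f 0)); rewrite [RHS]addrC -{2}fN -big_nat_recr //=.
  by rewrite [RHS]big_ltn // mul0r.
have NkN : (N %| N%:Z * k)%Z by apply: dvdz_mulr.
have [cN sN] := wcos_dvd NkN.
have e1 : P = P * wcos k - Q * wsin k.
  rewrite {1}/P -shift ?cN ?wcos0 // !mulr_suml -sumrB.
  by apply: eq_bigr => g _; rewrite wcosD.
have e2 : Q = Q * wcos k + P * wsin k.
  rewrite {1}/Q -shift ?sN ?wsin0 // !mulr_suml -big_split /=.
  by apply: eq_bigr => g _; rewrite wsinD.
have cs : wcos k ^+ 2 + wsin k ^+ 2 = 1 := cos2Dsin2 _.
have c1 : wcos k != 1 by apply: contra Nk => /eqP/wcos_eq1.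
rewrite -/P; have : P * (2 * (1 - wcos k)) = 0.
  move: e1 e2 cs; move: P Q (wcos k) (wsin k) => p q c s e1 e2 cs.
  have h1 : p * (1 - c) = - (q * s) by rewrite mulrBr mulr1 {1}e1; ring.
  have h2 : q * (1 - c) = p * s by rewrite mulrBr mulr1 {1}e2; ring.
  have -> : 2 * (1 - c) = (1 - c) ^+ 2 + s ^+ 2.
    have -> : s ^+ 2 = 1 - c ^+ 2 by rewrite -cs addrAC subrr add0r.
    by ring.
  have -> : p * ((1 - c) ^+ 2 + s ^+ 2) = p * (1 - c) * (1 - c) + p * s * s by ring.
  by rewrite h1 -h2; ring.
move=> /eqP; rewrite mulf_eq0 mulf_eq0 pnatr_eq0 /= subr_eq0 (eq_sym 1).
by rewrite (negPf c1) orbF => /eqP.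
Qed.

Variable X : seq int.

(** This is the squared modulus of the Fourier coefficient of [X] at [g], not the indexed energy. *)
Definition energy (g : int) : R :=
  (\sum_(a <- X) wcos (g * a)) ^+ 2 + (\sum_(a <- X) wsin (g * a)) ^+ 2.

Lemma energy_ge0 g : 0 <= energy g.
Proof. by rewrite addr_ge0 // sqr_ge0. Qed.

Lemma energy_sum g t :
  \sum_(a <- X) \sum_(c <- X) wcos (g * (a - c + t)) = energy g * wcos (g * t).
Proof.
pose P := \sum_(a <- X) wcos (g * a); pose Q := \sum_(a <- X) wsin (g * a).
have stepN s : \sum_(c <- X) wcos (s - g * c) = P * wcos s + Q * wsin s.
  rewrite !mulr_suml -big_split /=; apply: eq_bigr => c _.
  by rewrite wcosD wcosN wsinN; ring.
have c1 s : \sum_(a <- X) wcos (g * a + s) = P * wcos s - Q * wsin s.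
  by rewrite !mulr_suml -sumrB; apply: eq_bigr => a _; rewrite wcosD.
have s1 s : \sum_(a <- X) wsin (g * a + s) = P * wsin s + Q * wcos s.
  by rewrite !mulr_suml -big_split /=; apply: eq_bigr => a _; rewrite wsinD addrC.
rewrite (eq_bigr (fun a => P * wcos (g * a + g * t) + Q * wsin (g * a + g * t))).
  rewrite big_split /= -!mulr_sumr c1 s1 /energy -/P -/Q; ring.
move=> a _; rewrite -stepN; apply: eq_bigr => c _; congr wcos; ring.
Qed.

(** Two applications of [energy_sum]: the squared energy is the Fourier coefficient of the
    representation count of [a + b - c - d]. *)
Lemma energy2_sum g t :
  \sum_(b <- X) \sum_(d <- X) \sum_(a <- X) \sum_(c <- X) wcos (g * (a - c + (b - d + t)))
  = energy g ^+ 2 * wcos (g * t).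
Proof.
under eq_bigr => b _ do under eq_bigr => d _ do rewrite energy_sum.
under eq_bigr => b _ do rewrite -mulr_sumr.
by rewrite -mulr_sumr energy_sum mulrA.
Qed.

Hypothesis Xuniq : uniq X.
Hypothesis Xinj : {in X &, forall a b, (N %| a - b)%Z -> a = b}.

Lemma energyE g : energy g = \sum_(a <- X) \sum_(c <- X) wcos (g * (a - c)).
Proof.
rewrite -[LHS]mulr1 -wcos0 -(mulr0 g) -energy_sum.
by apply: eq_bigr => a _; apply: eq_bigr => c _; rewrite addr0.
Qed.

(** After exchanging sums, orthogonality keeps only the diagonal, because [X] is injective modulo
    [N]. *)
Lemma parseval : \sum_(g < N) energy g%:Z = N%:R * (size X)%:R.
Proof.
under eq_bigr do rewrite energyE.
rewrite exchange_big /=.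
rewrite (eq_big_seq (fun=> N%:R)).
  by rewrite big_const_seq count_predT iter_addr_0 mulr_natr.
move=> a aX; rewrite exchange_big /= (bigD1_seq a) //= wcos_sum subrr dvdz0.
rewrite big_seq_cond big1 ?addr0 // => c /andP[cX ca].
rewrite wcos_sum; case: ifP => // /(Xinj aX cX) e.
by rewrite e eqxx in ca.
Qed.

Lemma energy0 : energy 0 = (size X)%:R ^+ 2.
Proof.
rewrite /energy; under eq_bigr do rewrite mul0r wcos0.
under [X in _ + X ^+ 2]eq_bigr do rewrite mul0r wsin0.
rewrite big1_eq expr0n addr0 big_const_seq count_predT iter_addr_0 -mulr_natr mul1r //.
Qed.

End Fourier.

(** [G] collects the frequencies of energy at least [|X|^3 / (2 N)]; Parseval bounds their number.
    The condition on [x] makes all cosines at these frequencies nonnegative. *)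
Lemma bogolyubov (R : realType) (N : nat) (X : seq int) : uniq X ->
  {in X &, forall a b, (N %| a - b)%Z -> a = b} -> (0 < N)%N -> (0 < size X)%N ->
  exists2 G : seq nat, (size G * size X ^ 2 <= 2 * N ^ 2)%N &
    forall x : int,
      (forall g, g \in G -> exists2 r : int, (N %| g%:Z * x - r)%Z & (4 * `|r| <= N)%N) ->
      exists a b c d, [/\ a \in X, b \in X, c \in X, d \in X & (N %| a + b - c - d - x)%Z].
Proof.
move=> Xuniq Xinj N0 X0.
pose E (g : nat) : R := energy R N X g%:Z.
have N0' : 0 < N%:R :> R by rewrite ltr0n.
have X0' : 0 < (size X)%:R :> R by rewrite ltr0n.
have E0 g : 0 <= E g := energy_ge0 _ _ _ _.
have sumE : \sum_(g < N) E g = N%:R * (size X)%:R := parseval R N0 Xuniq Xinj.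
exists [seq g <- seq.iota 0 N | (size X)%:R ^+ 3 <= 2 * N%:R * E g].
  set G := [seq _ <- _ | _].
  have : (size X)%:R ^+ 3 *+ size G <= 2 * N%:R * (N%:R * (size X)%:R) :> R.
    rewrite -sumE mulr_sumr -(big_mkord xpredT (fun g => 2 * N%:R * E g)).
    rewrite /index_iota subn0 (bigID (fun g => (size X)%:R ^+ 3 <= 2 * N%:R * E g)) /=.
    rewrite -[X in X <= _]addr0; apply: lerD; last first.
      by apply: sumr_ge0 => g _; rewrite !mulr_ge0 // ltW.
    rewrite -big_filter -/G.
    rewrite -(count_predT G) -iter_addr_0 -(big_const_seq 0 +%R G xpredT).
    rewrite big_seq [leRHS]big_seq; apply: ler_sum => g; rewrite mem_filter => /andP[//].
  move=> h.
  have : (size X)%:R * ((size G * size X ^ 2)%:R : R) <= (size X)%:R * (2 * N ^ 2)%:R.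
    rewrite !natrM; move: h; rewrite -mulr_natr.
    move: (_%:R : R) => n; move: (_%:R : R) (_%:R : R) => q m; lra.
  by rewrite ler_pM2l // ler_nat.
move=> x xG.
(* The sum below is N times the number of representations of x; the frequency 0
   contributes |X|^4, and the frequencies outside G at most |X|^4 / 2. *)
apply: contrapT => none.
have : \sum_(g < N) E g ^+ 2 * wcos R N (g%:Z * - x) = 0.
  under eq_bigr => g _ do rewrite /E -energy2_sum.
  rewrite exchange_big big_seq big1 //= => b bX.
  rewrite exchange_big big_seq big1 //= => d dX.
  rewrite exchange_big big_seq big1 //= => a aX.
  rewrite exchange_big big_seq big1 //= => c cX.
  rewrite (wcos_sum R N0); case: ifP => // h; case: none.
  by exists a, b, c, d; split => //; rewrite (_ : _ - x = a - c + (b - d - x)) //; ring.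
apply/eqP; rewrite gt_eqF //.
(* The error term is subtracted at every frequency, so that Parseval sums it over all [g] to
   [|X|^4 / 2]. *)
have lb (g : 'I_N) : (g == 0%N :> nat)%:R * (size X)%:R ^+ 4 -
      (size X)%:R ^+ 3 / (2 * N%:R) * E g <= E g ^+ 2 * wcos R N (g%:Z * - x).
  have D0 : 0 <= (size X)%:R ^+ 3 / (2 * N%:R) * E g.
    by rewrite mulr_ge0 // divr_ge0 ?exprn_ge0 // ?mulr_ge0 // ltW.
  have [g0|g0] := eqVneq (g : nat) 0%N.
    have -> : E g = (size X)%:R ^+ 2 by rewrite /E g0 energy0.
    rewrite g0 mul0r wcos0 mul1r mulr1 -exprM gerBl.
    by rewrite mulr_ge0 ?exprn_ge0 // ?divr_ge0 ?exprn_ge0 ?mulr_ge0 // ltW.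
  rewrite mul0r sub0r.
  have [gbig|gsmall] := lerP ((size X)%:R ^+ 3) (2 * N%:R * E g).
    apply: (@le_trans _ _ 0); first by rewrite oppr_le0.
    apply: mulr_ge0; first exact: sqr_ge0.
    have [|r Nr r4] := xG g.
      by rewrite mem_filter gbig mem_iota add0n ltn_ord.
    by rewrite mulrN wcosN (wcos_mod R N0 Nr) wcos_ge0.
  have c1 : -1 <= wcos R N (g%:Z * - x) := cos_geN1 _.
  have h : E g <= (size X)%:R ^+ 3 / (2 * N%:R).
    by rewrite ler_pdivlMr ?mulr_gt0 // mulrC ltW.
  have := ler_wpM2r (E0 g) h; have := ler_wpM2l (sqr_ge0 (E g)) c1.
  rewrite expr2; lra.
apply: lt_le_trans (ler_sum _ (fun g _ => lb g)).
rewrite sumrB -mulr_sumr sumE -mulr_suml.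
have -> : \sum_(g < N) ((g == 0%N :> nat)%:R : R) = 1.
  case: (N) N0 => // n _; rewrite big_ord_recl /= big1 ?addr0 //.
rewrite mul1r (_ : _ / _ * _ = (size X)%:R ^+ 4 / 2); last first.
  by rewrite exprS; field; rewrite lt0r_neq0.
have : 0 < (size X)%:R ^+ 4 :> R by rewrite exprn_gt0.
lra.
Qed.

(** * Labelling a dense subset of a set of small doubling *)

Definition entry (F : pzRingType) n (j : 'I_n) (x : 'rV[F]_n) : F := x 0 j.

Lemma entry_is_scalar (F : pzRingType) n (j : 'I_n) : scalar (@entry F n j).
Proof. by move=> a x y; rewrite /entry !mxE. Qed.

HB.instance Definition _ (F : pzRingType) n (j : 'I_n) :=
  GRing.isLinear.Build F 'rV[F]_n F *%R (@entry F n j) (@entry_is_scalar F n j).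

Section CenteredResidue.
Variable N : nat.
Hypothesis N0 : (0 < N)%N.

Definition cres (x : int) : int :=
  if 2 * (x %% N)%Z <= N%:Z then (x %% N)%Z else (x %% N)%Z - N%:Z.

Lemma cres_dvd x : (N %| x - cres x)%Z.
Proof.
have := divz_eq x N; rewrite /cres; case: ifP => _ e; apply/dvdzP.
  by exists (x %/ N)%Z; lia.
by exists ((x %/ N)%Z + 1); lia.
Qed.

Lemma dvdz_small (x : int) : (N %| x)%Z -> (`|x| < N)%N -> x = 0.
Proof.
move=> /dvdzP[q ->]; rewrite abszM /= => h; suff -> : q = 0 by rewrite mul0r.
by apply/eqP; rewrite -absz_eq0; move: h; case: `|q|%N => // m; nia.
Qed.

Lemma cres_uniq x r : (N %| x - r)%Z -> (4 * `|r| <= N)%N -> cres x = r.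
Proof.
move=> h r4; apply/eqP; rewrite -subr_eq0; apply/eqP/dvdz_small.
  have -> : cres x - r = (x - r) - (x - cres x) by lia.
  by rewrite rpredB ?cres_dvd.
have N0' := N0.
have r0 : 0 <= (x %% N)%Z by rewrite modz_ge0 //; lia.
have rN : (x %% N)%Z < N by rewrite ltz_pmod //; lia.
rewrite /cres; move: (x %% N)%Z r0 rN => m r0 rN; case: ifP => h2; lia.
Qed.
End CenteredResidue.

(** * Labelling from a Freiman model and a Bohr set *)

Section OrderLabelling.
Variables (N : nat) (A : {fset int}) (th : int -> int) (n : nat) (gam : 'I_n -> int).
Hypothesis N0 : (0 < N)%N.
Hypothesis A0 : A != fset0.
Hypothesis freiman : forall u v : seq int, size u = 6 -> size v = 6 ->
  {subset u <= A} -> {subset v <= A} ->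
  (\sum_(a <- u) a = \sum_(a <- v) a -> \sum_(a <- u) th a = \sum_(a <- v) th a) /\
  ((N %| \sum_(a <- u) th a - \sum_(a <- v) th a)%Z -> \sum_(a <- u) a = \sum_(a <- v) a).
Hypothesis bohr : forall x : int,
  (forall i, exists2 r : int, (N %| gam i * x - r)%Z & (4 * `|r| <= N)%N) ->
  exists a b c d, [/\ a \in A, b \in A, c \in A, d \in A &
                     (N %| th a + th b - th c - th d - x)%Z].

Let V := 'rV[rat]_n.+1.
Let io : {scalar V} := @entry rat n.+1 ord0.
Let co (i : 'I_n) : {scalar V} := @entry rat n.+1 (lift ord0 i).
Let rad : rat := N%:R / 4.
Let s := enum 'I_n.

(** Coordinate 0 is the integer value, which carries the order; the others are residues at the
    frequencies [gam]. *)
Definition vec (z : int) (r : 'I_n -> int) : V :=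
  \row_j (if unlift ord0 j is Some i then (r i)%:~R else z%:~R).

Lemma io_vec z r : io (vec z r) = z%:~R.
Proof. by rewrite /io /= /entry mxE unlift_none. Qed.

Lemma co_vec i z r : co i (vec z r) = (r i)%:~R.
Proof. by rewrite /co /= /entry mxE liftK. Qed.

Lemma vecP (x y : V) : io x = io y -> (forall i, co i x = co i y) -> x = y.
Proof.
move=> e0 e; apply/rowP => j; case: (unliftP ord0 j) => [i ->|->]; first exact: e.
exact: e0.
Qed.

Lemma vecD z r z' r' : vec z r + vec z' r' = vec (z + z') (fun i => r i + r' i).
Proof. by apply: vecP => [|i]; rewrite linearD ?io_vec ?co_vec intrD. Qed.

Lemma vecN z r : - vec z r = vec (- z) (fun i => - r i).
Proof. by apply: vecP => [|i]; rewrite linearN ?io_vec ?co_vec mulrNz. Qed.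

Lemma vec_eq z r z' r' : z = z' -> (forall i, r i = r' i) -> vec z r = vec z' r'.
Proof. by move=> -> e; apply: vecP => [|i]; rewrite ?io_vec ?co_vec ?e. Qed.

Lemma box_vec z r : in_box co s rad (vec z r) <-> forall i, (4 * `|r i| <= N)%N.
Proof.
have E (m : int) : (`|m%:~R : rat| <= rad) = (4 * `|m| <= N)%N.
  by rewrite -intr_norm -abszE -pmulrn /rad ler_pdivlMr // -natrM ler_nat mulnC.
split => [/in_boxP h i|h]; first by have := h i; rewrite mem_enum co_vec E => /(_ isT).
by apply/in_boxP => i _; rewrite co_vec E.
Qed.

(* An element a + b - c - d of 2A - 2A is encoded together with the centered
   residues of its image under th at the frequencies gam; bohr_fset keeps the
   encodings with small residues. *)
Definition res2 (t : int) (i : 'I_n) : int := cres N (gam i * t).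
Definition quad (q : int * int * (int * int)) : V :=
  let: (a, b, (c, d)) := q in vec (a + b - c - d) (res2 (th a + th b - th c - th d)).
Definition quads : seq (int * int * (int * int)) :=
  let P := [seq (a, b) | a <- enum_fset A, b <- enum_fset A] in
  [seq (p, p') | p <- P, p' <- P].
Definition bohr_fset : {fset V} := [fset x in map quad quads | in_box co s rad x].

(** Any residues [r] of size at most [N / 4] may be supplied: by [cres_uniq] they are the centered
    ones. *)
Lemma bohr_fsetP (x : V) : reflect (exists a b c d z r,
  [/\ [/\ a \in A, b \in A, c \in A & d \in A],
   a + b - c - d = z, (forall i, N %| gam i * (th a + th b - th c - th d) - r i)%Z,
   (forall i, (4 * `|r i| <= N)%N) & x = vec z r]) (x \in bohr_fset).
Proof.
apply: (iffP idP).
  rewrite !inE => /andP[/mapP[[[a b] [c d]]]].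
  move=> /allpairsP[[p p'] [/= /allpairsP[[a1 b1] [/= aA bA ->]]]].
  move=> /allpairsP[[c1 d1] [/= cA dA ->]].
  move=> [-> -> -> ->] -> /= /box_vec h.
  exists a1, b1, c1, d1, (a1 + b1 - c1 - d1), (res2 (th a1 + th b1 - th c1 - th d1)).
  by split => // i; exact: cres_dvd.
move=> [a [b [c [d [z [r [[aA bA cA dA] ez er r4 ->]]]]]]]; rewrite !inE.
apply/andP; split; last exact/box_vec.
apply/mapP; exists (a, b, (c, d)).
  by apply/allpairsP; exists ((a, b), (c, d)); split=> //=; apply/allpairsP;
    [exists (a, b)|exists (c, d)].
by rewrite -ez /=; apply: vec_eq => // i; rewrite /res2 (cres_uniq N0 (er i)).
Qed.

Let subA (u : seq int) : all (mem A) u -> {subset u <= A}.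
Proof. by move/allP. Qed.

(** Moving the subtracted terms across leaves four summands a side, padded to six by copies of
    [a]. *)
Lemma freiman4 a b c d a' b' c' d' :
  [/\ a \in A, b \in A, c \in A & d \in A] -> [/\ a' \in A, b' \in A, c' \in A & d' \in A] ->
  a + b - c - d = a' + b' - c' - d' ->
  th a + th b - th c - th d = th a' + th b' - th c' - th d'.
Proof.
move=> [aA bA cA dA] [a'A b'A c'A d'A] e.
have [] := @freiman [:: a; b; c'; d'; a; a] [:: a'; b'; c; d; a; a] erefl erefl.
- by apply: subA; rewrite /= aA bA c'A d'A.
- by apply: subA; rewrite /= aA a'A b'A cA dA.
rewrite !big_cons !big_nil => h _.
have /h : a + (b + (c' + (d' + (a + (a + 0))))) = a' + (b' + (c + (d + (a + (a + 0))))).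
  by clear -e; lia.
by clear; lia.
Qed.

(** Needed for closure under addition. With the subtracted terms moved across there are six summands
    a side, whence the order 6 of the Freiman hypothesis. *)
Lemma freiman6 a b c d a' b' c' d' a'' b'' c'' d'' :
  [/\ a \in A, b \in A, c \in A & d \in A] -> [/\ a' \in A, b' \in A, c' \in A & d' \in A] ->
  [/\ a'' \in A, b'' \in A, c'' \in A & d'' \in A] ->
  (N %| th a'' + th b'' - th c'' - th d'' -
     (th a + th b - th c - th d + (th a' + th b' - th c' - th d')))%Z ->
  a'' + b'' - c'' - d'' = a + b - c - d + (a' + b' - c' - d').
Proof.
move=> [aA bA cA dA] [a'A b'A c'A d'A] [a''A b''A c''A d''A] e.
have [] := @freiman [:: a''; b''; c; d; c'; d'] [:: a; b; a'; b'; c''; d''] erefl erefl.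
- by apply: subA; rewrite /= a''A b''A cA dA c'A d'A.
- by apply: subA; rewrite /= aA bA a'A b'A c''A d''A.
rewrite !big_cons !big_nil => _ h.
suff /h : (N %| th a'' + (th b'' + (th c + (th d + (th c' + (th d' + 0))))) -
  (th a + (th b + (th a' + (th b' + (th c'' + (th d'' + 0)))))))%Z by clear; lia.
by move: e; congr (_ %| _)%Z; ring.
Qed.

(** For a sum with small residues, [bohr] represents [t + t'] modulo [N] by four elements of [A],
    and [freiman6] identifies their integer combination with [z + z']. *)
Lemma bohr_local_group : local_group co s rad bohr_fset.
Proof.
have [a0 a0A] := fset0Pn _ A0.
split.
- apply/bohr_fsetP; exists a0, a0, a0, a0, 0, (fun=> 0); split => //.
  + by ring.
  + by move=> i; rewrite subr0 (_ : _ - _ = 0) ?mulr0 ?dvdz0 //; ring.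
  + by apply: vecP => [|i]; rewrite ?io_vec ?co_vec linear0.
- by move=> x /bohr_fsetP[a [b [c [d [z [r [_ _ _ h ->]]]]]]]; apply/box_vec.
- move=> x /bohr_fsetP[a [b [c [d [z [r [[aA bA cA dA] ez er r4 ->]]]]]]].
  apply/bohr_fsetP; exists c, d, a, b, (- z), (fun i => - r i); split => //.
  + by rewrite -ez; ring.
  + by move=> i; rewrite -rpredN; move: (er i); congr (_ %| _)%Z; ring.
  + by move=> i; rewrite abszN.
  + exact: vecN.
move=> x y /bohr_fsetP[a [b [c [d [z [r [hA ez er r4 ->]]]]]]].
move=> /bohr_fsetP[a' [b' [c' [d' [z' [r' [hA' ez' er' r4' ->]]]]]]].
rewrite vecD => /box_vec h.
set t := th a + th b - th c - th d; set t' := th a' + th b' - th c' - th d'.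
have er2 i : (N %| gam i * (t + t') - (r i + r' i))%Z.
  by have := rpredD (er i) (er' i); congr (_ %| _)%Z; rewrite /t /t'; ring.
have [|a'' [b'' [c'' [d'' [a''A b''A c''A d''A e]]]]] := @bohr (t + t').
  by move=> i; exists (r i + r' i).
apply/bohr_fsetP; exists a'', b'', c'', d'', (z + z'), (fun i => r i + r' i); split => //.
  by rewrite -ez -ez'; exact: (freiman6 hA hA').
move=> i; have := rpredD (dvdz_mull (gam i) e) (er2 i); congr (_ %| _)%Z; ring.
Qed.

(** By [freiman4] the integer value determines the image under [th], hence the small residues. *)
Lemma bohr_iota_inj (x y : V) : x \in bohr_fset -> y \in bohr_fset -> io x = io y -> x = y.
Proof.
move=> /bohr_fsetP[a [b [c [d [z [r [hA ez er r4 ->]]]]]]].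
move=> /bohr_fsetP[a' [b' [c' [d' [z' [r' [hA' ez' er' r4' ->]]]]]]].
rewrite !io_vec => /eqP; rewrite eqr_int => /eqP zz'.
apply: vec_eq => // i.
rewrite -(cres_uniq N0 (er i) (r4 i)) -(cres_uniq N0 (er' i) (r4' i)).
by rewrite (freiman4 hA hA') // ez ez'.
Qed.

Lemma card_bohr_fset :
  (#|` bohr_fset| <= #|` sumset (nfold 2 A) (oppset (nfold 2 A))|)%N.
Proof.
rewrite -(size_map (fun x => numq (io x))); apply: uniq_leq_size.
  rewrite map_inj_in_uniq ?fset_uniq // => x y xW yW.
  have [a [b [c [d [z [r [_ _ _ _ ex]]]]]]] := bohr_fsetP _ xW.
  have [a' [b' [c' [d' [z' [r' [_ _ _ _ ey]]]]]]] := bohr_fsetP _ yW.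
  move=> e; apply: bohr_iota_inj => //; move: e.
  by rewrite ex ey !io_vec !numq_int => ->.
move=> _ /mapP[_ /bohr_fsetP[a [b [c [d [z [r [[aA bA cA dA] <- _ _ ->]]]]]]] ->].
rewrite io_vec numq_int (_ : _ - d = a + (b + 0) + - (c + (d + 0))); last by ring.
by apply: mem_sumset; last apply: mem_oppset; do !(apply: mem_sumset => //); rewrite inE.
Qed.
(** These residues lie in [[0, N)] and cut [A] into cells; it is differences within a cell that will
    lie in [bohr_fset]. *)
Definition res (a : int) (i : 'I_n) : int := ((gam i * th a) %% N)%Z.
Definition emb (a : int) : V := vec a (res a).

Lemma res_bound a i : 0 <= res a i < N%:Z.
Proof. by rewrite modz_ge0 ?ltz_pmod // -?lt0n //; have := N0; lia. Qed.

Lemma res_dvd a i : (N %| gam i * th a - res a i)%Z.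
Proof.
apply/dvdzP; exists (gam i * th a %/ N)%Z.
by have := divz_eq (gam i * th a) N; rewrite /res; lia.
Qed.

Lemma order_labelling : exists (B : {fset int}) (psi : int -> nat),
  [/\ B `<=` A, (#|` A| <= (256 * 32 ^ n).+1 ^ n * #|` B|)%N,
      {in B &, forall x y, x < y -> (psi x < psi y)%N},
      {in B, forall x, (psi x < #|` sumset (nfold 2 A) (oppset (nfold 2 A))|)%N} &
      forall v, exists2 L : seq nat, (size L <= 2 ^ n)%N &
        {in B &, forall x y, x + y = v -> (psi x + psi y)%N \in L}].
Proof.
(* The cell side [N / m] equals [lex_radius n * (N / 4)], the closeness that [lex_enumeration]
   demands. *)
set m := (256 * 32 ^ n)%N.
have m4 : (4 <= m)%N by rewrite /m; have : (0 < 32 ^ n)%N; [rewrite expn_gt0|lia].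
have N0' := N0.
pose cell a : {ffun 'I_n -> 'I_m.+1} := [ffun i => inord `|(res a i * m%:Z %/ N)%Z|%N].
have [j] := @fset_pigeonhole _ _ A cell (enum {ffun 'I_n -> 'I_m.+1}) A0
  (fun a _ => mem_enum _ _).
rewrite -cardE card_ffun !card_ord; set B := [fset _ in _ | _] => cB.
have BA x : x \in B -> x \in A by rewrite !inE => /andP[].
have BAs : B `<=` A by apply/fsubsetP.
have close x y i : x \in B -> y \in B -> (`|res x i - res y i| * m < N)%N.
  rewrite !inE => /andP[_ /eqP/ffunP/(_ i)] + /andP[_ /eqP/ffunP/(_ i)].
  rewrite !ffunE => <- /(congr1 val).
  have /andP[x0 xN] := res_bound x i; have /andP[y0 yN] := res_bound y i.
  have qb z : 0 <= z < N%:Z -> 0 <= (z * m%:Z %/ N)%Z < m%:Z.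
    by move=> /andP[z0 zN]; rewrite divz_ge0 ?ltz_divLR ?mulr_ge0 //; nia.
  have hx := qb _ (res_bound x i); have hy := qb _ (res_bound y i).
  rewrite /= !inordK; try by move: hx hy; clear; lia.
  move=> e; have {e} : (res x i * m%:Z %/ N)%Z = (res y i * m%:Z %/ N)%Z.
    by move: hx hy e; clear; lia.
  have ex := divz_eq (res x i * m%:Z) N; have ey := divz_eq (res y i * m%:Z) N.
  have mx0 : 0 <= (res x i * m%:Z %% N)%Z by rewrite modz_ge0 //; lia.
  have my0 : 0 <= (res y i * m%:Z %% N)%Z by rewrite modz_ge0 //; lia.
  have mxN : (res x i * m%:Z %% N)%Z < N by rewrite ltz_pmod //; lia.
  have myN : (res y i * m%:Z %% N)%Z < N by rewrite ltz_pmod //; lia.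
  move=> e; rewrite e in ex.
  have : `|(res x i - res y i) * m%:Z| < N%:Z.
    by rewrite mulrBl {1}ex {1}ey; move: mx0 my0 mxN myN; clear; lia.
  by rewrite normrM -!abszE; clear; lia.
have close4 x y i : x \in B -> y \in B -> (4 * `|res x i - res y i| <= N)%N.
  by move=> xB yB; have := close x y i xB yB; nia.
have embB x y : emb x - emb y = vec (x - y) (fun i => res x i - res y i).
  by rewrite vecN vecD.
have rad0 : 0 < rad by rewrite divr_gt0 // ltr0n.
have BW : {in [fset emb a | a in B] &, forall x y, x - y \in bohr_fset /\
    in_box co s (lex_radius rat (size s) * rad) (x - y)}.
  move=> _ _ /imfsetP[x /= xB ->] /imfsetP[y /= yB ->]; rewrite embB; split.
    apply/bohr_fsetP; exists x, x, x, y, (x - y), (fun i => res x i - res y i); split => //.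
    - by rewrite !BA.
    - by ring.
    - move=> i; have := rpredB (res_dvd x i) (res_dvd y i); congr (_ %| _)%Z; ring.
    - by move=> i; exact: close4.
  apply/in_boxP => i _; rewrite co_vec -intr_norm -abszE -pmulrn.
  have := close x y i xB yB; rewrite size_enum_ord /lex_radius /rad.
  rewrite -(ltr_nat rat) natrM /m natrM natrX => h.
  have b0 : 0 < 32 ^+ n :> rat by rewrite exprn_gt0.
  move: h b0; move: (_%:R) (32 ^+ n : rat) (N%:R : rat) => a b c h b0.
  rewrite mulrC ler_pdivlMr; last by rewrite pmulr_rgt0.
  by lra.
have Winj : {in bohr_fset, forall x : V, io x = 0 -> x = 0}.
  have [W0 _ _ _] := bohr_local_group.
  by move=> x xW x0; apply: bohr_iota_inj => //; rewrite linear0.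
have [phi [phi_mono phi_lt phi_sum]] := lex_enumeration rad0 bohr_local_group Winj BW.
have BE x : x \in B -> emb x \in [fset emb a | a in B] by move=> xB; apply/imfsetP; exists x.
exists B, (phi \o emb); split => //.
- by move=> x y xB yB xy; apply: phi_mono; rewrite ?BE // !io_vec ltr_int.
- by move=> x xB; apply: leq_trans (phi_lt _ (BE x xB)) card_bohr_fset.
move=> v; have [[x0 [y0 [x0B y0B e0]]]|none] :=
  pselect (exists x y, [/\ x \in B, y \in B & x + y = v]); last first.
  by exists [::] => // x y xB yB e; case: none; exists x, y.
have [L sL LP] := phi_sum (emb x0 + emb y0).
exists L; first by rewrite -[n in (2 ^ n)%N]size_enum_ord.
move=> x y xB yB e; apply: LP; rewrite ?BE //.
rewrite !vecD; apply: vec_eq; first by rewrite e.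
(* Residue sums of two representations of [v] agree modulo [N] by [freiman4] and differ by at most
   [N / 2] within a cell. They are equal, so [emb x + emb y] depends only on [v]. *)
move=> i /=; apply/eqP; rewrite -subr_eq0; apply/eqP/(dvdz_small N0).
  have : th x + th y - th x0 - th y0 = 0.
    rewrite (@freiman4 x y x0 y0 x x x x) ?BA //; first by ring.
    by rewrite e -e0; ring.
  move=> h.
  have -> : res x i + res y i - (res x0 i + res y0 i) =
      (gam i * th x0 - res x0 i + (gam i * th y0 - res y0 i)) -
      (gam i * th x - res x i + (gam i * th y - res y i)) +
      gam i * (th x + th y - th x0 - th y0) by ring.
  by rewrite h mulr0 addr0 rpredB // rpredD // res_dvd.
have := close4 x x0 i xB x0B; have := close4 y y0 i yB y0B.
by move: N0'; clear; lia.
Qed.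
End OrderLabelling.

(** * Extracting indexed energy *)

Fixpoint greedy_count (F : pred nat) (q t : nat) : nat :=
  if t is t'.+1 then
    (greedy_count F q t' + (F t' && (q * greedy_count F q t' <= t')))%N
  else 0%N.

Definition greedy F q t := F t && (q * greedy_count F q t <= t)%N.

(* Excludes the elements selected while catching up after a gap of F. *)
Definition on_pace F q t := greedy F q t && (t < q * greedy_count F q t + q)%N.

Lemma greedy_countE F q M : greedy_count F q M = (\sum_(t < M) greedy F q t)%N.
Proof. by elim: M => [|M IHM]; rewrite ?big_ord0 // big_ord_recr -IHM. Qed.

Lemma on_pace_count F q t : on_pace F q t -> greedy_count F q t = (t %/ q)%N.
Proof.
move=> /andP[/andP[_ h1] h2]; apply/eqP; rewrite eqn_leq; apply/andP; split.
  by rewrite leq_divRL; nia.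
by rewrite -ltnS ltn_divLR; nia.
Qed.

(** Each point of [F] is skipped, selected on pace, or selected late. With [G] on-pace selections,
    at most [(q - 1) G] points are skipped and at most [M / q] are late. *)
Lemma on_pace_many (F : pred nat) q M : (0 < q)%N ->
  (q * \sum_(t < M) F t <= M + q * q * \sum_(t < M) on_pace F q t)%N.
Proof.
move=> q0.
pose G := (\sum_(t < M) on_pace F q t)%N.
(* An on-pace selection causes at most q - 1 elements to be skipped. *)
have ahead : (\sum_(t < M) (t < q * greedy_count F q t)%N
    + (q * greedy_count F q M - M) <= q.-1 * G)%N.
  rewrite /G; elim: M {G} => [|M]; first by rewrite !big_ord0 /= muln0.
  rewrite !big_ord_recr /= /on_pace /greedy.
  move: (greedy_count F q M) (\sum_(_ < _) _)%N (\sum_(_ < _) _)%N => n a b.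
  case: (F M) => /=; case: (leqP (q * n) M) => h /=;
    try (case: (ltnP M (q * n + q)) => h' /=); nia.
(* A late selection at [t] has [q * (n + 1) <= t], where [n] elements are already selected. The
   earlier late ones are among these [n], so both bounds are proved together. *)
have late : (\sum_(t < M) (greedy F q t && ~~ on_pace F q t) <= greedy_count F q M)%N /\
   (q * \sum_(t < M) (greedy F q t && ~~ on_pace F q t) <= M)%N.
  elim: M {G ahead} => [|M]; first by rewrite !big_ord0 /= muln0.
  rewrite !big_ord_recr /= /on_pace /greedy.
  move: (greedy_count F q M) (\sum_(_ < _) _)%N => n a.
  case: (F M) => /=; case: (leqP (q * n) M) => h /=;
    try (case: (ltnP M (q * n + q)) => h' /=); nia.
have split : (\sum_(t < M) F t <= \sum_(t < M) (t < q * greedy_count F q t)%N + G +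
    \sum_(t < M) (greedy F q t && ~~ on_pace F q t))%N.
  rewrite -!big_split /=; apply: leq_sum => t _; rewrite /on_pace /greedy.
  case: (F t) => /=; case: (leqP (q * greedy_count F q t) t) => h /=;
    case: (ltnP t (q * greedy_count F q t + q)) => h2 /=; lia.
move: ahead late split; rewrite -/G.
move: G (greedy_count F q M) (\sum_(_ < _) _)%N (\sum_(_ < _) _)%N (\sum_(_ < _) _)%N => g n a b c.
nia.
Qed.

(** * Cauchy-Schwarz and the indexed energy *)

Lemma sum_sqr_le (T : Type) (s : seq T) (r : T -> nat) :
  ((\sum_(i <- s) r i) ^ 2 <= size s * \sum_(i <- s) r i ^ 2)%N.
Proof.
elim: s => [|x s]; first by rewrite !big_nil.
rewrite !big_cons /=; move: (size s) (\sum_(_ <- _) _)%N (\sum_(_ <- _) _)%N (r x) => n b a c h.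
(* For nonzero [n], multiply by [n] and combine [2 * (n * c) * a <= (n * c) ^ 2 + a ^ 2] with
   [a ^ 2 <= n * b]. *)
have : (2 * (c * a) <= n * c ^ 2 + b)%N.
  case: n h => [|n] h.
    by move: h; rewrite mul0n leqn0 expn_eq0 => /andP[/eqP -> _]; rewrite !muln0.
  rewrite -(leq_pmul2l (ltn0Sn n)).
  apply: (@leq_trans ((n.+1 * c) ^ 2 + a ^ 2)); last by nia.
  by rewrite mulnCA (mulnA _ c); have [] := nat_Cauchy (n.+1 * c) a.
nia.
Qed.

(** Cauchy-Schwarz on the fibre sizes of [f]: they sum to the size of [P], and their squares count
    the collisions. *)
Lemma collision_count (T U : eqType) (f : T -> U) (P : seq T) (L : seq U) :
  {in P, forall p, f p \in L} ->
  (size P ^ 2 <= size L * \sum_(p <- P) count (fun p' => f p' == f p) P)%N.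
Proof.
move=> fL; pose r v := count (fun p => f p == v) P.
have expand (g : U -> nat) : (\sum_(p <- P) g (f p) = \sum_(v <- undup L) r v * g v)%N.
  rewrite (eq_big_seq (fun p => \sum_(v <- undup L) (f p == v) * g v)%N).
    rewrite exchange_big /=; apply: eq_bigr => v _.
    by rewrite -big_distrl /= /r -sum1_count [in RHS]big_mkcond.
  move=> p /fL pL; rewrite (bigD1_seq (f p)) ?undup_uniq ?mem_undup //=.
  rewrite eqxx mul1n big1 ?addn0 // => v; rewrite eq_sym => /negPf -> //.
have -> : size P = (\sum_(v <- undup L) r v)%N.
  by rewrite -sum1_size (expand (fun=> 1%N)); under eq_bigr do rewrite muln1.
rewrite (expand r); under [X in (_ <= _ * X)%N]eq_bigr do rewrite mulnn.
by apply: leq_trans (sum_sqr_le _ _) _; rewrite leq_mul2r size_undup orbT.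
Qed.

Lemma card_fset_sep (T : choiceType) (A : {fset T}) (p : pred T) :
  #|` [fset x in A | p x]| = count p (enum_fset A).
Proof.
rewrite -size_filter; apply: perm_size; apply: uniq_perm.
- exact: fset_uniq.
- by rewrite filter_uniq ?fset_uniq.
by move=> x; rewrite mem_filter !inE andbC.
Qed.

Definition rank (B : {fset int}) (a : int) : nat := count (fun b => b < a) (enum_fset B).

Lemma index_increasing_enum (B : {fset int}) a :
  a \in B -> index a (increasing_enum B) = rank B a.
Proof.
move=> aB; have pB : perm_eq (increasing_enum B) (enum_fset B) by rewrite perm_sort.
have aS : a \in increasing_enum B by rewrite (perm_mem pB).
have srt : sorted <%O (increasing_enum B).
  by rewrite lt_sorted_uniq_le (perm_uniq pB) fset_uniq sort_le_sorted.
rewrite /rank -(permP pB) -{2}(nth_index 0 aS).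
by rewrite (count_lt_nth _ srt) // index_mem.
Qed.

Lemma size_increasing_enum (B : {fset int}) : size (increasing_enum B) = #|` B|.
Proof. by rewrite size_sort. Qed.

(** Two pairs from [G] with the same sum and the same rank sum give a quadruple counted by [EI B];
    ranks are taken in [B]. *)
Lemma EI_ge (B G : {fset int}) (L : seq (int * nat)) : G `<=` B ->
  {in G &, forall a b, (a + b, (rank B a + rank B b)%N) \in L} ->
  (#|` G| ^ 4 <= size L * EI B)%N.
Proof.
move=> /fsubsetP GB GL.
have [->|/fset0Pn[g0 g0G]] := eqVneq G fset0; first by rewrite cardfs0.
pose key (p : int * int) := (p.1 + p.2, (rank B p.1 + rank B p.2)%N).
pose P := [seq (a, b) | a <- enum_fset G, b <- enum_fset G].
have PG p : p \in P -> p.1 \in G /\ p.2 \in G by move=> /allpairsP[[a b] [/= aG bG ->]].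
have keyL : {in P, forall p, key p \in L} by move=> p /PG[h1 h2]; exact: GL.
have := collision_count keyL; rewrite size_allpairs mulnn -expnM => h.
apply: leq_trans h _; rewrite leq_mul2l; apply/orP; right.
pose Q := [seq (p, p') | p <- P, p' <- [seq p' <- P | key p' == key p]].
have -> : (\sum_(p <- P) count (fun p' => key p' == key p) P)%N = size Q.
  rewrite size_allpairs_dep sumnE big_map.
  by apply: eq_bigr => p _; rewrite size_filter.
have lt_rank a : a \in G -> (rank B a < #|` B|)%N.
  move=> /GB aB; rewrite -index_increasing_enum // -size_increasing_enum index_mem.
  by rewrite mem_sort.
pose o a : 'I_#|` B| := insubd (Ordinal (lt_rank g0 g0G)) (rank B a).
have oE a : a \in G -> o a = rank B a :> nat by move=> aG; rewrite val_insubd lt_rank.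
have nth_o a : a \in G -> nth 0 (increasing_enum B) (o a) = a.
  by move=> aG; rewrite oE // -index_increasing_enum ?GB // nth_index // mem_sort GB.
pose h (q : (int * int) * (int * int)) := (o q.1.1, o q.1.2, o q.2.1, o q.2.2).
have PQ q : q \in Q -> [/\ q.1 \in P, q.2 \in P & key q.2 = key q.1].
  by move=> /allpairsPdep[p [p' [pP]]]; rewrite mem_filter => /andP[/eqP e p'P] ->.
rewrite /EI -(size_map h) cardE; apply: uniq_leq_size.
  rewrite map_inj_in_uniq.
    apply: allpairs_uniq_dep.
    - by apply: allpairs_uniq; rewrite ?fset_uniq // => -[? ?] [? ?].
    - move=> p _; rewrite filter_uniq //.
      by apply: allpairs_uniq; rewrite ?fset_uniq // => -[? ?] [? ?].
    - by move=> [? ?] [? ?] _ _ /= [-> ->].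
  move=> [[a b] [c d]] [[a' b'] [c' d']] /PQ[/PG[/= aG bG] /PG[/= cG dG] _].
  move=> /PQ[/PG[/= a'G b'G] /PG[/= c'G d'G] _] [ea eb ec ed].
  by rewrite -(nth_o a) // -(nth_o b) // -(nth_o c) // -(nth_o d) // ea eb ec ed !nth_o.
move=> _ /mapP[[[a b] [c d]] /PQ[/PG[/= aG bG] /PG[/= cG dG] [e1 e2]] ->].
by rewrite mem_enum inE /h /= !nth_o // e1 !oE // e2 !eqxx.
Qed.

(* The greedy selection is applied to the labels phi; an element selected on
   pace has rank exactly phi %/ q, so ranks inherit the additivity of phi. *)
Lemma indexed_energy_extract (B : {fset int}) (phi : int -> nat) (M S m q : nat) :
  (0 < q)%N ->
  {in B &, forall x y, x < y -> (phi x < phi y)%N} ->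
  {in B, forall x, (phi x < M)%N} ->
  (forall v, exists2 L : seq nat, (size L <= S)%N &
     {in B &, forall x y, x + y = v -> (phi x + phi y)%N \in L}) ->
  (#|` sumset B B| <= m)%N ->
  exists B' G : {fset int}, [/\ B' `<=` B, G `<=` B',
    (q * #|` B| <= M + q * q * #|` G|)%N &
    (#|` G| ^ 4 <= m * (S * 2) * EI B')%N].
Proof.
move=> q0 phi_mono phi_lt phi_sum Bm.
have phi_inj : {in B &, injective phi}.
  move=> x y xB yB e; apply/eqP; rewrite eq_le !leNgt; apply/andP; split; apply/negP.
    by move=> /(phi_mono _ _ yB xB); rewrite e ltnn.
  by move=> /(phi_mono _ _ xB yB); rewrite e ltnn.
pose F t := t \in [seq phi x | x <- enum_fset B].
have count_phi (P : pred nat) : (forall t, P t -> F t) ->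
    (\sum_(t < M) P t)%N = #|` [fset x in B | P (phi x)]|.
  move=> PF; rewrite -(big_mkord xpredT (fun t => P t : nat)) /index_iota subn0.
  have -> : (\sum_(t <- iota 0 M) P t)%N = size [seq t <- iota 0 M | P t].
    by rewrite size_filter -sum1_count [RHS]big_mkcond; apply: eq_bigr => t _; case: (P t).
  rewrite -(size_map phi); apply: perm_size; apply: uniq_perm.
  - by rewrite filter_uniq ?iota_uniq.
  - rewrite map_inj_in_uniq ?fset_uniq // => x y.
    by rewrite !inE => /andP[xB _] /andP[yB _]; exact: phi_inj.
  move=> t; rewrite mem_filter mem_iota add0n /=; apply/andP/mapP.
    move=> [Pt tM]; have /mapP[x xB e] := PF t Pt.
    by exists x; rewrite ?inE ?xB -?e.
  by move=> [x]; rewrite !inE => /andP[xB Px] ->; rewrite phi_lt.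
have cB : (\sum_(t < M) F t)%N = #|` B|.
  rewrite count_phi //; congr #|` _|; apply/fsetP => x; rewrite !inE.
  by rewrite andb_idr // => xB; apply: map_f.
pose B' := [fset x in B | greedy F q (phi x)].
pose G := [fset x in B | on_pace F q (phi x)].
have GB' : G `<=` B'.
  by apply/fsubsetP => x; rewrite !inE => /andP[-> /andP[->]].
have B'B : B' `<=` B by apply/fsubsetP => x; rewrite !inE => /andP[].
(* As [phi] is increasing, the rank of [x] in [B'] is the number of labels selected before
   [phi x]. *)
have rankE x : x \in G -> rank B' x = (phi x %/ q)%N.
  rewrite !inE => /andP[xB xG]; rewrite -(on_pace_count xG) greedy_countE.
  rewrite /rank -card_fset_sep (big_ord_widen M (fun t => greedy F q t : nat));
    last by rewrite ltnW // phi_lt.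
  rewrite big_mkcond.
  transitivity #|` [fset y in B | greedy F q (phi y) && (phi y < phi x)%N]|.
    congr #|` _|; apply/fsetP => y; rewrite !inE -andbA; case: (boolP (y \in B)) => //= yB.
    congr (_ && _); apply/idP/idP; first exact: phi_mono.
    rewrite ltNge; apply: contraLR; rewrite negbK le_eqVlt.
    by move=> /predU1P[->|/(phi_mono _ _ xB yB)]; lia.
  rewrite -(count_phi (fun t => greedy F q t && (t < phi x)%N));
    last by move=> t /andP[/andP[]].
  by apply: eq_bigr => t _; rewrite andbC; case: (_ < _)%N.
exists B', G; split => //.
  by have := on_pace_many F M q0; rewrite cB count_phi // => t /andP[/andP[]].
(* Quotients by [q] of two labels with sum [l] add up to [l %/ q] or one less, hence the factor
   2. *)
pose Lv (v : int) := [seq (v, k) | l <- sval (cid2 (phi_sum v)),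
                                   k <- [:: l %/ q; (l %/ q).-1]%N].
pose L := flatten [seq Lv v | v <- enum_fset (sumset B B)].
have sL : (size L <= m * (S * 2))%N.
  apply: leq_trans (leq_mul Bm (leqnn _)).
  rewrite /L size_flatten sumnE !big_map.
  have -> : (#|` sumset B B| * (S * 2))%N = (\sum_(v <- enum_fset (sumset B B)) S * 2)%N.
    by rewrite big_const_seq count_predT iter_addn addn0 mulnC.
  apply: leq_sum => v _; rewrite size_allpairs_dep.
  case: (cid2 _) => L0 L0S _ /=.
  by rewrite sumnE big_map big_const_seq count_predT iter_addn addn0 mulnC leq_mul2r.
apply: leq_trans (leq_mul sL (leqnn _)); apply: EI_ge => // x y xG yG.
have GB z : z \in G -> z \in B by move=> /(fsubsetP GB')/(fsubsetP B'B).
apply/flattenP; exists (Lv (x + y)).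
  by apply: map_f; rewrite mem_sumset ?GB.
apply/allpairsPdep; exists (phi x + phi y)%N, (rank B' x + rank B' y)%N; split => //.
  by case: (cid2 _) => L0 _ /= L0P; apply: L0P; rewrite ?GB.
rewrite !rankE // !inE divnD //.
by case: (_ <= _)%N; rewrite ?addn1 ?addn0 /= eqxx ?orbT.
Qed.

(** * Assembly and constants *)

Lemma sumsetS (A B C D : {fset int}) : A `<=` B -> C `<=` D -> sumset A C `<=` sumset B D.
Proof.
move=> /fsubsetP AB /fsubsetP CD; apply/fsubsetP => _ /sumsetP[a /AB aB [c /CD cD ->]].
exact: mem_sumset.
Qed.

Lemma nfoldS n (A B : {fset int}) : A `<=` B -> nfold n A `<=` nfold n B.
Proof. by move=> AB; elim: n => //= n; exact: sumsetS. Qed.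

Lemma oppsetS (A B : {fset int}) : A `<=` B -> oppset A `<=` oppset B.
Proof.
by move=> /fsubsetP AB; apply/fsubsetP => _ /imfsetP[a /= /AB aB ->]; exact: mem_oppset.
Qed.

Lemma small_doubling_labelling (R : realType) (k : nat) : exists C S : nat,
  forall A : {fset int}, A != fset0 -> (#|` sumset A A| <= k * #|` A|)%N ->
  exists (B : {fset int}) (psi : int -> nat),
  [/\ B `<=` A, (#|` A| <= C * #|` B|)%N,
      {in B &, forall x y, x < y -> (psi x < psi y)%N},
      {in B, forall x, (psi x < k ^ 4 * #|` A|)%N} &
      forall v, exists2 L : seq nat, (size L <= S)%N &
        {in B &, forall x y, x + y = v -> (psi x + psi y)%N \in L}].
Proof.
(* [d] bounds the number of frequencies: [N <= 3 k^12 |A| <= 18 k^12 |A1|] is inserted in the bound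
   [|G| |A1|^2 <= 2 N^2]. *)
pose d := (2 * (18 * k ^ 12) ^ 2)%N.
exists (6 * (256 * 32 ^ d).+1 ^ d)%N, (2 ^ d)%N => A A0 AA.
set N := (2 * #|` sumset (nfold 6 A) (oppset (nfold 6 A))|).+1.
have cA : (0 < #|` A|)%N by rewrite cardfs_gt0.
have Nk : (N <= 3 * k ^ 12 * #|` A|)%N.
  have k0 : (0 < k ^ 12)%N.
    rewrite expn_gt0; case: (posnP k) => // k0; move: AA; rewrite k0 leqn0 cardfs_eq0.
    have [a aA] := fset0Pn _ A0.
    by move=> /eqP/fsetP/(_ (a + a)); rewrite inE mem_sumset.
  have := plunnecke 6 6 A0 AA; rewrite /N; nia.
have [A1 [th [A1A cA1 freiman]]] := ruzsa_model A0 (isT : (0 < 6)%N) (ltnSn _ : (_ < N)%N).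
have A10 : A1 != fset0 by rewrite -cardfs_gt0; lia.
(* Six copies of [a] against six copies of [b] turn the Freiman property into injectivity modulo
   [N]. *)
have th_inj : {in A1 &, forall a b, (N %| th a - th b)%Z -> a = b}.
  move=> a b aA bA ab.
  have [||_] := freiman (nseq 6 a) (nseq 6 b) (size_nseq _ _) (size_nseq _ _).
  - by move=> x; rewrite mem_nseq => /eqP ->.
  - by move=> x; rewrite mem_nseq => /eqP ->.
  rewrite !big_nseq_cond /= => h.
  suff /h : (N %| th a + (th a + (th a + (th a + (th a + (th a + 0))))) -
      (th b + (th b + (th b + (th b + (th b + (th b + 0)))))))%Z by clear; lia.
  have -> : forall x y : int, x + (x + (x + (x + (x + (x + 0))))) -
    (y + (y + (y + (y + (y + (y + 0)))))) = 6 * (x - y) by move=> x y; ring.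
  exact: dvdz_mull.
have th_inj' : {in enum_fset A1 &, injective th}.
  by move=> a b aA bA e; apply: th_inj => //; rewrite e subrr dvdz0.
have [||||G sG bohr] := @bogolyubov R N (map th (enum_fset A1)).
- by rewrite map_inj_in_uniq ?fset_uniq.
- by move=> _ _ /mapP[a aA ->] /mapP[b bA ->] /(th_inj _ _ aA bA) ->.
- by [].
- by rewrite size_map cardfs_gt0.
rewrite size_map in sG.
have sGd : (size G <= d)%N.
  have cA1' : (0 < #|` A1|)%N by rewrite cardfs_gt0.
  have h : (N <= 18 * k ^ 12 * #|` A1|)%N by nia.
  rewrite -(@leq_pmul2r (#|` A1| ^ 2)) ?expn_gt0 ?cA1' //.
  apply: leq_trans sG _; rewrite /d -mulnA -expnMn leq_mul2l /=.
  by rewrite leq_exp2r.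
pose gam (i : 'I_(size G)) : int := (nth 0%N G i)%:Z.
have bohr' x : (forall i, exists2 r : int, (N %| gam i * x - r)%Z & (4 * `|r| <= N)%N) ->
  exists a b c e, [/\ a \in A1, b \in A1, c \in A1, e \in A1 &
                     (N %| th a + th b - th c - th e - x)%Z].
  move=> h; have [|a' [b' [c' [e' [aX bX cX eX dvd]]]]] := bohr x.
    move=> g gG; have gi : (index g G < size G)%N by rewrite index_mem.
    by have := h (Ordinal gi); rewrite /gam /= nth_index.
  move: aX bX cX eX dvd => /mapP[a aA ->] /mapP[b bA ->] /mapP[c cA' ->] /mapP[e eA ->] dvd.
  by exists a, b, c, e.
have [B [psi [BA cB mono lt sums]]] := order_labelling (isT : (0 < N)%N) A10 freiman bohr'.
exists B, psi; split => //.
- exact: fsubset_trans A1A.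
- apply: leq_trans cA1 _; rewrite -mulnA leq_mul2l /=; apply: leq_trans cB _.
  rewrite leq_mul2r; apply/orP; right.
  apply: (@leq_trans ((256 * 32 ^ d).+1 ^ size G)).
    case: (size G) sGd => [|e] sGd; first by rewrite !expn0.
    by rewrite leq_exp2r // ltnS leq_mul2l leq_pexp2l ?orbT.
  by rewrite leq_pexp2l.
- move=> x xB; apply: leq_trans (lt x xB) _.
  apply: leq_trans (plunnecke 2 2 A0 AA).
  by apply/fsubset_leq_card/sumsetS; [|apply: oppsetS]; apply: nfoldS.
- move=> v; have [L sL LP] := sums v; exists L => //.
  by apply: leq_trans sL _; rewrite leq_pexp2l.
Qed.

Lemma indexed_energy_small_doubling (R : realType) (k : nat) : exists E H : nat,
  forall A : {fset int}, A != fset0 -> (#|` sumset A A| <= k * #|` A|)%N ->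
  exists A' : {fset int},
  [/\ A' `<=` A, (#|` A'| ^ 3 <= H * EI A')%N & (#|` A| <= E * #|` A'|)%N].
Proof.
have [C [S CS]] := small_doubling_labelling R k.
(* The label range is at most [k ^ 4 * C * |B|], less than half of [q * |B|], so the extraction
   gives [|B| <= q * q * |G|] and then [|A| <= E * |G|]. *)
pose q := (2 * (k ^ 4 * C) + 1)%N; pose E := (C * (q * q))%N.
exists E, (E ^ 4 * (k * (S * 2)))%N => A A0 AA.
have [B [psi [BA cB mono lt sums]]] := CS A A0 AA.
have cA : (0 < #|` A|)%N by rewrite cardfs_gt0.
have BB : (#|` sumset B B| <= k * #|` A|)%N.
  exact: leq_trans (fsubset_leq_card (sumsetS BA BA)) AA.
have q0 : (0 < q)%N by rewrite /q addn1.
have [A' [G [A'B GA' cG eG]]] := indexed_energy_extract q0 mono lt sums BB.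
have cG' := fsubset_leq_card GA'.
have A'A : A' `<=` A := fsubset_trans A'B BA.
have AG : (#|` A| <= E * #|` G|)%N.
  apply: (leq_trans cB); rewrite /E -mulnA leq_mul2l; apply/orP; right.
  have h : (k ^ 4 * #|` A| <= k ^ 4 * C * #|` B|)%N by rewrite -mulnA leq_mul2l cB orbT.
  move: cG h; rewrite /q; move: (k ^ 4 * C)%N (k ^ 4 * #|` A|)%N => a b; nia.
exists A'; split => //; last by apply: leq_trans AG _; rewrite leq_mul2l cG' orbT.
have G0 : (0 < #|` G|)%N by case: (#|` G|) AG => // ; rewrite muln0; lia.
(* Replacing [|A|] by [E * |G|] in the bound for [|G|^4] lets one factor [|G|] cancel. *)
have G3 : (#|` G| ^ 3 <= k * (S * 2) * E * EI A')%N.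
  rewrite -(leq_pmul2l G0) -expnS; apply: leq_trans eG _.
  have := leq_mul (leqnn (k * (S * 2) * EI A')%N) AG.
  move: (k) (S * 2)%N (EI A') (#|` A|) (E) (#|` G|) => a b c e f g; nia.
apply: (@leq_trans (#|` A| ^ 3)); first by rewrite leq_exp2r // fsubset_leq_card.
apply: (@leq_trans ((E * #|` G|) ^ 3)); first by rewrite leq_exp2r.
rewrite expnMn; apply: leq_trans (leq_mul (leqnn _) G3) _.
by rewrite (expnS E 3); move: (E ^ 3)%N (k * (S * 2))%N (E) (EI A') => a b c e; nia.
Qed.

Theorem theorem10 (R : realType) (K : R) (hK : 0 < K) :
  exists c1 c2 : R, [/\ 0 < c1, 0 < c2 &
    forall A : {fset int},
      (#|` sumset A A|)%:R <= K * (#|` A|)%:R ->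
      exists A' : {fset int},
        [/\ A' `<=` A,
            c1 * (#|` A'|)%:R ^+ 3 <= (EI A')%:R &
            c2 * (#|` A|)%:R <= (#|` A'|)%:R]].
Proof.
set k := (Num.truncn K).+1.
have Kk : K <= k%:R by rewrite ltW // truncnS_gt.
have [E [H EH]] := indexed_energy_small_doubling R k.
(* Successors guarantee positive denominators. *)
exists H.+1%:R^-1, E.+1%:R^-1; split; rewrite ?invr_gt0 ?ltr0n // => A AK.
have [->|A0] := eqVneq A fset0.
  by exists fset0; rewrite fsubset_refl cardfs0 expr0n !mulr0.
have AA : (#|` sumset A A| <= k * #|` A|)%N.
  by rewrite -(ler_nat R) natrM; apply: le_trans AK _; rewrite ler_wpM2r.
have [A' [A'A hE hA]] := EH A A0 AA.
exists A'; split => //.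
  rewrite mulrC ler_pdivrMr ?ltr0n // -natrX -natrM ler_nat mulnC.
  by apply: leq_trans hE _; rewrite leq_mul2r leqnSn orbT.
rewrite mulrC ler_pdivrMr ?ltr0n // -natrM ler_nat mulnC.
by apply: leq_trans hA _; rewrite leq_mul2r leqnSn orbT.
Qed.
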